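(* Let $\kappa \le 0$, let $X$ be a CBB$(\kappa)$ space, let $Y$ be a complete CAT$(\kappa)$ space and let $A \subseteq X$ be nonempty. Then the multivalued mapping $\Phi_c : \mathcal{N}(A,Y) \to \mathcal{P}(\mathcal{N}(X,Y))$, assigning to each $f\in\mathcal{N}(A,Y)$ the set of all $f'\in\mathcal{N}(X,Y)$ with $f'|_A=f$ and $f'(X)\subseteq\overline{\mathrm{co}}(f(A))$, is lower semi-continuous.
   Context: For $\kappa\le0$, a geodesic space is CAT$(\kappa)$ (resp. CBB$(\kappa)$) if every geodesic triangle satisfies $\le$ (resp. $\ge$) when comparing distances between points on it with distances between corresponding points of its comparison triangle in the model surface $M^2_\kappa$. $\mathcal{N}(A,Y)$ is the set of bounded nonexpansive maps $A\to Y$ with the supremum metric $d_\infty$. For $C\subseteq Y$, $G_1(C)$ is the union of all geodesic segments with endpoints in $C$, $G_n(C)=G_1(G_{n-1}(C))$, $\mathrm{co}(C)=\bigcup_n G_n(C)$, $\overline{\mathrm{co}}(C)$ its closure. A multivalued map $\Gamma:U\to\mathcal{P}(Z)$ is lower semi-continuous if $\{u:\Gamma(u)\cap V\neq\emptyset\}$ is open for every open $V$. *)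

(* Defs.v *)
From Stdlib Require Import Reals Lra.
Open Scope R_scope.

Section Defs.
Context {X : Type}.

Definition is_metric (d : X -> X -> R) : Prop :=
  (forall x y, 0 <= d x y) /\ (forall x y, d x y = 0 <-> x = y) /\
  (forall x y, d x y = d y x) /\ (forall x y z, d x z <= d x y + d y z).

Definition geodesic (d : X -> X -> R) (x y : X) (g : R -> X) : Prop :=
  g 0 = x /\ g 1 = y /\
  forall s t, 0 <= s <= 1 -> 0 <= t <= 1 -> d (g s) (g t) = Rabs (s - t) * d x y.

Definition geodesic_space (d : X -> X -> R) : Prop :=
  forall x y, exists g, geodesic d x y g.

Definition complete (d : X -> X -> R) : Prop :=
  forall u : nat -> X,
    (forall eps, 0 < eps -> exists N, forall m n, (N <= m)%nat -> (N <= n)%nat -> d (u m) (u n) < eps) ->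
    exists l, forall eps, 0 < eps -> exists N, forall n, (N <= n)%nat -> d (u n) l < eps.
End Defs.

(* kappa = 0 : Euclidean plane R^2;
   kappa < 0 : upper half-plane with the hyperbolic metric rescaled by 1/sqrt(-kappa). *)
Definition arcosh (u : R) : R := ln (u + sqrt (u * u - 1)).

Definition model_pt (kappa : R) (p : R * R) : Prop :=
  kappa = 0 \/ (kappa < 0 /\ 0 < snd p).

Definition model_d (kappa : R) (p q : R * R) : R :=
  let dx := fst p - fst q in let dy := snd p - snd q in
  if Req_EM_T kappa 0 then sqrt (dx * dx + dy * dy)
  else arcosh (1 + (dx * dx + dy * dy) / (2 * snd p * snd q)) / sqrt (- kappa).

(* p is the point at parameter t on the (unique) model geodesic from a to b *)
Definition model_seg (kappa : R) (a b : R * R) (t : R) (p : R * R) : Prop :=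
  model_pt kappa p /\ model_d kappa a p = t * model_d kappa a b /\
  model_d kappa p b = (1 - t) * model_d kappa a b.

Definition nxt (i : nat) : nat := match i with 0%nat => 1%nat | 1%nat => 2%nat | _ => 0%nat end.

Section Tri.
Context {X : Type}.

Definition geod_triangle (d : X -> X -> R) (V : nat -> X) (G : nat -> R -> X) : Prop :=
  forall i, (i < 3)%nat -> geodesic d (V i) (V (nxt i)) (G i).

Definition comparison_triangle (kappa : R) (d : X -> X -> R) (V : nat -> X)
  (V' : nat -> R * R) : Prop :=
  forall i, (i < 3)%nat ->
    model_pt kappa (V' i) /\ model_d kappa (V' i) (V' (nxt i)) = d (V i) (V (nxt i)).

Definition triangle_cmp (rel : R -> R -> Prop) (kappa : R) (d : X -> X -> R)
  (G : nat -> R -> X) (V' : nat -> R * R) : Prop :=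
  forall i j s t p q, (i < 3)%nat -> (j < 3)%nat -> 0 <= s <= 1 -> 0 <= t <= 1 ->
    model_seg kappa (V' i) (V' (nxt i)) s p ->
    model_seg kappa (V' j) (V' (nxt j)) t q ->
    rel (d (G i s) (G j t)) (model_d kappa p q).

Definition CAT (kappa : R) (d : X -> X -> R) : Prop :=
  geodesic_space d /\
  forall V G V', geod_triangle d V G -> comparison_triangle kappa d V V' ->
    triangle_cmp Rle kappa d G V'.

Definition CBB (kappa : R) (d : X -> X -> R) : Prop :=
  geodesic_space d /\
  forall V G V', geod_triangle d V G -> comparison_triangle kappa d V V' ->
    triangle_cmp Rge kappa d G V'.

Definition G1 (d : X -> X -> R) (C : X -> Prop) : X -> Prop :=
  fun y => exists a b g t, C a /\ C b /\ geodesic d a b g /\ 0 <= t <= 1 /\ y = g t.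

Fixpoint Gn (d : X -> X -> R) (C : X -> Prop) (n : nat) : X -> Prop :=
  match n with 0%nat => C | S n => G1 d (Gn d C n) end.

Definition co (d : X -> X -> R) (C : X -> Prop) : X -> Prop :=
  fun y => exists n, Gn d C (S n) y.

Definition closure (d : X -> X -> R) (C : X -> Prop) : X -> Prop :=
  fun y => forall eps, 0 < eps -> exists c, C c /\ d y c < eps.

Definition closed_co (d : X -> X -> R) (C : X -> Prop) : X -> Prop :=
  closure d (co d C).
End Tri.

Section Maps.
Context {X Y : Type}.

(* f : X -> Y represents a map A -> Y (values outside A are irrelevant) *)
Definition nonexp_bounded (dX : X -> X -> R) (dY : Y -> Y -> R) (A : X -> Prop) (f : X -> Y) : Prop :=
  (forall a b, A a -> A b -> dY (f a) (f b) <= dX a b) /\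
  (exists M, forall a b, A a -> A b -> dY (f a) (f b) <= M).

Definition dsup_lt (dY : Y -> Y -> R) (A : X -> Prop) (f g : X -> Y) (eps : R) : Prop :=
  exists m, is_lub (fun r => exists a, A a /\ r = dY (f a) (g a)) m /\ m < eps.

Definition open_in_N (dX : X -> X -> R) (dY : Y -> Y -> R) (A : X -> Prop)
  (U : (X -> Y) -> Prop) : Prop :=
  forall f, nonexp_bounded dX dY A f -> U f ->
    exists eps, 0 < eps /\
      forall g, nonexp_bounded dX dY A g -> dsup_lt dY A f g eps -> U g.

Definition Phi_c (dX : X -> X -> R) (dY : Y -> Y -> R) (A : X -> Prop) (f h : X -> Y) : Prop :=
  nonexp_bounded dX dY (fun _ => True) h /\ (forall a, A a -> h a = f a) /\
  (forall x, closed_co dY (fun y => exists a, A a /\ y = f a) (h x)).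

Definition Phi_c_lsc (dX : X -> X -> R) (dY : Y -> Y -> R) (A : X -> Prop) : Prop :=
  forall V : (X -> Y) -> Prop, open_in_N dX dY (fun _ => True) V ->
    open_in_N dX dY A (fun f => exists h, Phi_c dX dY A f h /\ V h).
End Maps.

(* Main.v *)
Require Import Defs.
From Stdlib Require Import Reals Lra Lia List Classical ClassicalEpsilon.
From mathcomp Require classical_sets.
Open Scope R_scope.

(* Write k = -kappa and measure distances by md(d) = d^2/2 (kappa = 0) or (cosh(sqrt k d) - 1)/k.
   Then both curvature bounds say that moving from p towards a changes md(u, .) to first order
   by at least (CBB), at most (CAT), E_p(u,a) = md(u,a) - md(p,a) - md(u,p)(1 + k md(p,a)),
   which is minus the scalar product of the directions of u and a at p.

   In a CBB space sum_ij w_i w_j E_p(a_i,a_j) <= 0 for nonnegative weights (Lang-Schroeder, Sturm):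
   otherwise a walk of small steps towards the barycentre of the a_i would move away from its own
   endpoint.  In a CAT space this inequality yields the one-point extension of Kirszbraun's
   theorem: subgradient descent for max_i (md(y,y_i) - r_i) must reach an almost common point of
   finitely many balls, and infinitely many balls then meet by completeness and convexity.

   For lower semi-continuity let h extend f and let g be close to f.  Move h slightly to h' with
   values in co(g(A)).  Place A at height 0 and a copy of X at height s in the (warped) product
   of X with a line, with values g and h'.  If s is small but dominates the distance from g to f,
   the extra height absorbs the perturbation, and the one-point extensions to X x {0} inside
   the closed hull of g(A) still exist; they give an extension of g close to h. *)

(** * Identities and monotonicity of hyperbolic functions *)

Lemma exp_neg_mul x : exp x * exp (- x) = 1.
Proof. rewrite <- exp_plus, Rplus_opp_r. apply exp_0. Qed.

Lemma cosh_sq x : cosh x * cosh x = 1 + sinh x * sinh x.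
Proof.
  unfold cosh, sinh. pose proof (exp_neg_mul x). nra.
Qed.

Lemma cosh_ge_1 x : 1 <= cosh x.
Proof.
  pose proof (cosh_sq x). assert (0 < cosh x).
  { unfold cosh. pose proof (exp_pos x). pose proof (exp_pos (- x)). lra. }
  nra.
Qed.

Lemma cosh_neg x : cosh (- x) = cosh x.
Proof. unfold cosh. rewrite Ropp_involutive. lra. Qed.

Lemma sinh_neg x : sinh (- x) = - sinh x.
Proof. unfold sinh. rewrite Ropp_involutive. lra. Qed.

Lemma cosh_add x y : cosh (x + y) = cosh x * cosh y + sinh x * sinh y.
Proof. unfold cosh, sinh. rewrite Ropp_plus_distr, !exp_plus. field. Qed.

Lemma sinh_add x y : sinh (x + y) = sinh x * cosh y + cosh x * sinh y.
Proof. unfold cosh, sinh. rewrite Ropp_plus_distr, !exp_plus. field. Qed.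

Lemma cosh_sub x y : cosh (x - y) = cosh x * cosh y - sinh x * sinh y.
Proof. unfold Rminus. rewrite cosh_add, cosh_neg, sinh_neg. lra. Qed.

Lemma exp_cosh_sinh x : exp x = cosh x + sinh x.
Proof. unfold cosh, sinh. field. Qed.

Lemma sinh_le x y : x <= y -> sinh x <= sinh y.
Proof. intros [H| ->]; [left; now apply sinh_lt | right; reflexivity]. Qed.

Lemma sinh_nonneg x : 0 <= x -> 0 <= sinh x.
Proof. intros H. rewrite <- sinh_0. now apply sinh_le. Qed.

Lemma cosh_diff x y : x < y -> exists c, cosh y - cosh x = sinh c * (y - x) /\ x < c < y.
Proof. intros H. apply (MVT_cor2 cosh sinh); [exact H|]. intros; apply derivable_pt_lim_cosh. Qed.

Lemma cosh_lt x y : 0 <= x -> x < y -> cosh x < cosh y.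
Proof.
  intros Hx H. destruct (cosh_diff x y H) as (c & E & Hc).
  assert (0 < sinh c) by (rewrite <- sinh_0; apply sinh_lt; lra). nra.
Qed.

Lemma cosh_le x y : 0 <= x -> x <= y -> cosh x <= cosh y.
Proof. intros H0 [H| ->]; [left; now apply cosh_lt | right; reflexivity]. Qed.

Lemma sinh_mvt x : 0 < x -> exists c, sinh x = cosh c * x /\ 0 < c < x.
Proof.
  intros H. destruct (MVT_cor2 sinh cosh 0 x H) as (c & E & Hc).
  - intros; apply derivable_pt_lim_sinh.
  - exists c. rewrite sinh_0, !Rminus_0_r in E. auto.
Qed.

Lemma sinh_ge x : 0 <= x -> x <= sinh x.
Proof.
  intros [H| <-]; [|rewrite sinh_0; lra].
  destruct (sinh_mvt x H) as (c & E & _). pose proof (cosh_ge_1 c). nra.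
Qed.

Lemma sinh_le_linear x D : 0 <= x <= D -> sinh x <= cosh D * x.
Proof.
  intros [[H| <-] HD]; [|rewrite sinh_0; lra].
  destruct (sinh_mvt x H) as (c & E & Hc).
  assert (cosh c <= cosh D) by (apply cosh_le; lra). nra.
Qed.

Lemma cosh_double x : cosh (2 * x) = 1 + 2 * (sinh x * sinh x).
Proof. replace (2 * x) with (x + x) by lra. rewrite cosh_add, cosh_sq. lra. Qed.

Lemma arcosh_cosh x : 0 <= x -> arcosh (cosh x) = x.
Proof.
  intros H. unfold arcosh. rewrite cosh_sq.
  replace (1 + sinh x * sinh x - 1) with (sinh x * sinh x) by lra.
  rewrite sqrt_square by now apply sinh_nonneg.
  rewrite <- exp_cosh_sinh. apply ln_exp.
Qed.

Lemma cosh_arcosh c : 1 <= c -> cosh (arcosh c) = c /\ 0 <= arcosh c.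
Proof.
  intros H. unfold arcosh. set (s := sqrt (c * c - 1)).
  assert (Hs : s * s = c * c - 1) by (apply sqrt_sqrt; nra).
  assert (0 <= s) by apply sqrt_pos. split.
  - unfold cosh. rewrite exp_Ropp, exp_ln by lra. field_simplify; [|lra].
    replace (c ^ 2 + 2 * c * s + s ^ 2 + 1) with (2 * c * (c + s)) by nra. field. lra.
  - rewrite <- ln_1. destruct (Req_dec (c + s) 1) as [->|]; [lra|]. left. apply ln_increasing; lra.
Qed.

(** * Modified distance *)

(* The classical modified distance function: in these units the comparison
   inequality along a geodesic has the same polynomial shape for every curvature. *)
Definition md (kappa d : R) : R :=
  if Req_EM_T kappa 0 then d * d / 2 else (cosh (sqrt (- kappa) * d) - 1) / - kappa.

(** The generalised sine, which is the derivative of [md kappa]. *)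
Definition sn (kappa d : R) : R :=
  if Req_EM_T kappa 0 then d else sinh (sqrt (- kappa) * d) / sqrt (- kappa).

(* First-order increment of the modified distance to [u] when moving from [p]
   towards [a], in terms of [ua], [pa], [up]; it is minus the generalised scalar product
   of the directions of [u] and [a] at [p]. *)
Definition incr (k ua pa up : R) : R := ua - pa - up * (1 + k * pa).

Section Md.
Variable kappa : R.
Hypothesis Hk : kappa <= 0.

Lemma sqrt_neg_pos : kappa <> 0 -> 0 < sqrt (- kappa) /\ sqrt (- kappa) * sqrt (- kappa) = - kappa.
Proof. intros H. split; [apply sqrt_lt_R0; lra | apply sqrt_sqrt; lra]. Qed.

Lemma md_0 : md kappa 0 = 0.
Proof.
  unfold md. destruct Req_EM_T as [e|e]; [lra|]. rewrite Rmult_0_r, cosh_0. field. lra.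
Qed.

Lemma sn_nonneg d : 0 <= d -> 0 <= sn kappa d.
Proof.
  intros H. unfold sn. destruct Req_EM_T as [e|e]; [lra|].
  destruct (sqrt_neg_pos e) as [Hq _].
  apply Rmult_le_pos; [apply sinh_nonneg; nra | left; now apply Rinv_0_lt_compat].
Qed.

Lemma sn_lt x y : x < y -> sn kappa x < sn kappa y.
Proof.
  intros H. unfold sn. destruct Req_EM_T as [e|e]; [lra|].
  destruct (sqrt_neg_pos e) as [Hq _].
  apply Rmult_lt_compat_r; [now apply Rinv_0_lt_compat|]. apply sinh_lt. nra.
Qed.

Lemma sn_0 : sn kappa 0 = 0.
Proof.
  unfold sn. destruct Req_EM_T as [e|e]; [lra|]. rewrite Rmult_0_r, sinh_0. unfold Rdiv; lra.
Qed.

Lemma sn_le x y : x <= y -> sn kappa x <= sn kappa y.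
Proof. intros [H| ->]; [left; now apply sn_lt | right; reflexivity]. Qed.

Lemma sn_ge x : 0 <= x -> x <= sn kappa x.
Proof.
  intros H. unfold sn. destruct Req_EM_T as [e|e]; [lra|].
  destruct (sqrt_neg_pos e) as [Hq _]. set (q := sqrt (- kappa)) in *.
  assert (q * x <= sinh (q * x)) by (apply sinh_ge; nra).
  apply Rmult_le_reg_l with q; [exact Hq|]. field_simplify; lra.
Qed.

Lemma sn_sq d : sn kappa d * sn kappa d = md kappa d * (2 - kappa * md kappa d).
Proof.
  unfold sn, md. destruct Req_EM_T as [e|e]; [subst; field|].
  destruct (sqrt_neg_pos e) as [Hq Hqq]. set (q := sqrt (- kappa)) in *.
  pose proof (cosh_sq (q * d)) as C.
  replace (sinh (q * d) / q * (sinh (q * d) / q)) with (sinh (q * d) * sinh (q * d) / (q * q)) by (field; lra).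
  rewrite Hqq. replace (sinh (q * d) * sinh (q * d)) with (cosh (q*d) * cosh (q*d) - 1) by lra.
  field. lra.
Qed.

Lemma md_ge d : d * d / 2 <= md kappa d.
Proof.
  unfold md. destruct Req_EM_T as [e|e]; [lra|].
  destruct (sqrt_neg_pos e) as [Hq Hqq]. set (q := sqrt (- kappa)) in *.
  assert (G : forall d, 0 <= d -> d * d / 2 <= (cosh (q * d) - 1) / - kappa).
  { clear d; intros d Hd. rewrite <- Hqq. apply Rmult_le_reg_r with (q * q); [nra|].
    replace ((cosh (q * d) - 1) / (q * q) * (q * q)) with (cosh (q * d) - 1) by (field; lra).
    replace (q * d) with (2 * (q * d / 2)) by lra. rewrite cosh_double.
    assert (0 <= q * d / 2) by nra.
    assert (q * d / 2 <= sinh (q * d / 2)) by now apply sinh_ge. nra. }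
  destruct (Rle_dec 0 d) as [Hd|Hd]; [now apply G|].
  specialize (G (- d)). replace (q * - d) with (- (q * d)) in G by ring. rewrite cosh_neg in G.
  replace (d * d) with (- d * - d) by ring. apply G. lra.
Qed.

Lemma md_nonneg d : 0 <= md kappa d.
Proof. pose proof (md_ge d). nra. Qed.

Lemma md_lt x y : 0 <= x -> x < y -> md kappa x < md kappa y.
Proof.
  intros H0 H. unfold md. destruct Req_EM_T as [e|e]; [nra|].
  destruct (sqrt_neg_pos e) as [Hq _].
  apply Rmult_lt_compat_r; [apply Rinv_0_lt_compat; lra|].
  assert (cosh (sqrt (- kappa) * x) < cosh (sqrt (- kappa) * y)) by (apply cosh_lt; nra). lra.
Qed.

Lemma md_le x y : 0 <= x -> x <= y -> md kappa x <= md kappa y.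
Proof. intros H0 [H| ->]; [left; now apply md_lt | right; reflexivity]. Qed.

Lemma md_le_inv x y : 0 <= y -> md kappa x <= md kappa y -> x <= y.
Proof.
  intros H0 H. destruct (Rle_dec x y) as [|n]; [assumption|].
  pose proof (md_lt y x H0 ltac:(lra)). lra.
Qed.

(** Mean value theorem: the derivative [sn kappa] is increasing, so its value at [D] bounds all
    slopes on the interval. *)
Lemma md_lipschitz D x y :
  0 <= x <= D -> 0 <= y <= D -> md kappa x - md kappa y <= sn kappa D * Rabs (x - y).
Proof.
  intros Hx Hy. pose proof (sn_nonneg D ltac:(lra)) as HD.
  destruct (Rle_dec x y) as [H|H].
  { pose proof (md_le x y ltac:(lra) H). pose proof (Rabs_pos (x - y)). nra. }
  rewrite Rabs_right by lra. revert HD. unfold md, sn.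
  destruct Req_EM_T as [e|e]; [nra|]. intros _.
  destruct (sqrt_neg_pos e) as [Hq Hqq]. set (q := sqrt (- kappa)) in *.
  destruct (cosh_diff (q * y) (q * x) ltac:(nra)) as (c & E & Hc).
  assert (sinh c <= sinh (q * D)) by (apply sinh_le; nra).
  rewrite <- Hqq.
  replace ((cosh (q * x) - 1) / (q * q) - (cosh (q * y) - 1) / (q * q))
    with ((cosh (q * x) - cosh (q * y)) / (q * q)) by (field; lra).
  rewrite E. replace (sinh c * (q * x - q * y) / (q * q)) with (sinh c * ((x - y) / q)) by (field; lra).
  replace (sinh (q * D) / q * (x - y)) with (sinh (q * D) * ((x - y) / q)) by (field; lra).
  apply Rmult_le_compat_r; [|assumption].
  apply Rmult_le_pos; [lra | left; now apply Rinv_0_lt_compat].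
Qed.

(** Makes the modified distance covered by a short walk a second-order quantity. The crude constant
    comes from [cosh (2 z) - 1 = 2 sinh(z)^2] and [sinh_le_linear]. *)
Lemma md_quadratic D : 0 <= D -> exists C, 0 <= C /\ forall x, 0 <= x <= D -> md kappa x <= C * (x * x).
Proof.
  intros HD. unfold md. destruct Req_EM_T as [e|e].
  { exists (1/2). split; [lra|]. intros; lra. }
  destruct (sqrt_neg_pos e) as [Hq Hqq]. set (q := sqrt (- kappa)) in *.
  exists (cosh (q * D) * cosh (q * D)). split.
  { pose proof (cosh_ge_1 (q * D)). nra. }
  intros x Hx. rewrite <- Hqq. apply Rmult_le_reg_r with (q * q); [nra|].
  replace ((cosh (q * x) - 1) / (q * q) * (q * q)) with (cosh (q * x) - 1) by (field; lra).
  replace (cosh (q * x)) with (cosh (2 * (q * x / 2))) by (f_equal; lra). rewrite cosh_double.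
  assert (0 <= q * x) by nra.
  assert (S : sinh (q * x / 2) <= cosh (q * D) * (q * x / 2)) by (apply sinh_le_linear; nra).
  pose proof (sinh_nonneg (q * x / 2) ltac:(lra)).
  pose proof (cosh_ge_1 (q * D)).
  assert (sinh (q * x / 2) * sinh (q * x / 2) <= (cosh (q * D) * (q * x / 2)) * (cosh (q * D) * (q * x / 2))) by nra.
  nra.
Qed.

(** The hinge formula is linear in [sn] of the length travelled. Reparametrising by this [s] gives
    the first-order increment the exact coefficient [t]. *)
Lemma sn_fraction L t : 0 <= L -> 0 <= t <= 1 -> exists s, 0 <= s <= L /\ sn kappa s = t * sn kappa L.
Proof.
  intros HL Ht. unfold sn. destruct Req_EM_T as [e|e]; [exists (t * L); split; nra|].
  destruct (sqrt_neg_pos e) as [Hq _]. set (q := sqrt (- kappa)) in *.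
  pose proof (sinh_nonneg (q * L) ltac:(nra)).
  assert (A : 0 <= arcsinh (t * sinh (q * L)) <= q * L).
  { split.
    - rewrite <- arcsinh_0. apply arcsinh_le. nra.
    - rewrite <- (arcsinh_sinh (q * L)) at 2. apply arcsinh_le. nra. }
  exists (arcsinh (t * sinh (q * L)) / q). split.
  - split; [apply Rmult_le_pos; [lra| left; now apply Rinv_0_lt_compat]|].
    apply Rmult_le_reg_r with q; [exact Hq|]. field_simplify; lra.
  - replace (q * (arcsinh (t * sinh (q * L)) / q)) with (arcsinh (t * sinh (q * L))) by (field; lra).
    rewrite sinh_arcsinh. field. lra.
Qed.

Lemma sn_half L : sn kappa L = 2 * sn kappa (L / 2) * (1 - kappa * md kappa (L / 2)).
Proof.
  unfold sn, md. destruct Req_EM_T as [e|e]; [subst; lra|].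
  destruct (sqrt_neg_pos e) as [Hq _]. set (q := sqrt (- kappa)) in *.
  replace (q * L) with (q * (L / 2) + q * (L / 2)) by field. rewrite sinh_add. field. lra.
Qed.

Lemma md_half L : md kappa L = 2 * md kappa (L / 2) * (2 - kappa * md kappa (L / 2)).
Proof.
  rewrite Rmult_assoc, <- sn_sq. unfold sn, md. destruct Req_EM_T as [e|e]; [subst; lra|].
  destruct (sqrt_neg_pos e) as [Hq Hqq]. set (q := sqrt (- kappa)) in *.
  replace (q * L) with (2 * (q * (L / 2))) by field. rewrite cosh_double, <- Hqq. field. lra.
Qed.

(** * Comparison triangles *)

Lemma model_d_cosh p q c :
  kappa <> 0 -> 0 < snd p -> 0 < snd q -> 1 <= c ->
  (fst p - fst q) * (fst p - fst q) + (snd p - snd q) * (snd p - snd q) = (c - 1) * (2 * snd p * snd q) ->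
  model_d kappa p q = arcosh c / sqrt (- kappa).
Proof.
  intros e Hp Hq Hc E. unfold model_d. destruct Req_EM_T as [e'|_]; [contradiction|].
  rewrite E. f_equal. f_equal. field. lra.
Qed.

Lemma model_d_cosh_eq p q d :
  kappa <> 0 -> 0 < snd p -> 0 < snd q -> 0 <= d ->
  (fst p - fst q) * (fst p - fst q) + (snd p - snd q) * (snd p - snd q) =
    (cosh (sqrt (- kappa) * d) - 1) * (2 * snd p * snd q) ->
  model_d kappa p q = d.
Proof.
  intros e Hp Hq Hd E. destruct (sqrt_neg_pos e) as [Hs _].
  rewrite (model_d_cosh p q _ e Hp Hq (cosh_ge_1 _) E).
  rewrite arcosh_cosh by nra. field. lra.
Qed.

(** A model triangle together with the points of its side from [p] to [a]. The last equation is the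
    law of cosines, used twice to eliminate the angle at [p]; [model_d kappa u u = 0] lets [u] count
    as the point at parameter 0 of the side from [u] to [p]. *)
Definition straight_model_triangle (L r rho : R) (p a u : R * R) : Prop :=
  model_pt kappa p /\ model_pt kappa a /\ model_pt kappa u /\
  model_d kappa p a = L /\ model_d kappa a u = rho /\ model_d kappa u p = r /\ model_d kappa u u = 0 /\
  forall tau, 0 <= tau <= 1 -> exists g, model_seg kappa p a tau g /\ 0 <= model_d kappa g u /\
    sn kappa L * (md kappa (model_d kappa g u) - md kappa r - md kappa (tau * L) * (1 - kappa * md kappa r))
    = sn kappa (tau * L) * incr (- kappa) (md kappa rho) (md kappa L) (md kappa r).

(** With [p] at the origin and [a] on the first axis, the law of cosines gives the abscissa [x] of
    [u]. The triangle inequalities place [x] between [-r] and [r], so the ordinate exists. *)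
Lemma flat_model_triangle L r rho :
  kappa = 0 -> 0 < L -> 0 <= r -> 0 <= rho -> L <= r + rho -> r <= L + rho -> rho <= L + r ->
  exists p a u, straight_model_triangle L r rho p a u.
Proof.
  intros e HL Hr HR T1 T2 T3. unfold straight_model_triangle, incr, model_seg, model_pt, model_d, md, sn.
  destruct Req_EM_T as [_|]; [|contradiction].
  set (x := (r * r + L * L - rho * rho) / (2 * L)).
  assert (Hx : 2 * L * x = r * r + L * L - rho * rho) by (unfold x; field; lra).
  assert (Hy : 0 <= r * r - x * x).
  { assert (- r <= x <= r); [|nra].
    split; (apply Rmult_le_reg_l with (2 * L); [lra|]); rewrite Hx.
    - assert (rho * rho <= (L + r) * (L + r)) by nra. nra.
    - destruct (Rle_dec r L); nra. }
  set (y := sqrt (r * r - x * x)).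
  assert (Hyy : y * y = r * r - x * x) by now apply sqrt_sqrt.
  assert (S : forall z w, 0 <= z -> w = z * z -> sqrt w = z) by (intros z w Hz ->; now apply sqrt_square).
  exists (0, 0), (L, 0), (x, y). simpl.
  repeat (split; [first [now left | apply S; nra]|]).
  intros tau Ht. exists (tau * L, 0). simpl. repeat split.
  - now left.
  - rewrite (S L ((0 - L) * (0 - L) + (0 - 0) * (0 - 0))) by lra. apply S; nra.
  - rewrite (S L ((0 - L) * (0 - L) + (0 - 0) * (0 - 0))) by lra. apply S; nra.
  - apply sqrt_pos.
  - rewrite sqrt_sqrt by (apply Rplus_le_le_0_compat; apply Rle_0_sqr). rewrite e.
    replace (rho * rho) with (r * r + L * L - 2 * L * x) by lra.
    replace (r * r) with (x * x + y * y) by lra. field.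
Qed.

(** The side from [p] to [a] is put on the vertical axis of the half-plane, where arc length is the
    logarithm of the height; lengths are first rescaled by [q]. *)
Lemma hyperbolic_model_triangle L r rho :
  kappa <> 0 -> 0 < L -> 0 <= r -> 0 <= rho -> L <= r + rho -> r <= L + rho -> rho <= L + r ->
  exists p a u, straight_model_triangle L r rho p a u.
Proof.
  intros e HL Hr HR T1 T2 T3.
  destruct (sqrt_neg_pos e) as [Hq Hqq].
  assert (MD : forall d, md kappa d = (cosh (sqrt (- kappa) * d) - 1) / - kappa)
    by (intros; unfold md; now destruct Req_EM_T).
  assert (SN : forall d, sn kappa d = sinh (sqrt (- kappa) * d) / sqrt (- kappa))
    by (intros; unfold sn; now destruct Req_EM_T).
  set (q := sqrt (- kappa)) in *.
  set (l := q * L). set (b := q * r). set (c := q * rho).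
  assert (Hl : 0 < l) by (unfold l; nra). assert (Hb : 0 <= b) by (unfold b; nra).
  assert (Hc : 0 <= c) by (unfold c; nra).
  assert (Cs : cosh (b - l) <= cosh c).
  { destruct (Rle_dec 0 (b - l)); [apply cosh_le; unfold b, l, c in *; nra|].
    rewrite <- cosh_neg. apply cosh_le; unfold b, l, c in *; nra. }
  assert (Ca : cosh c <= cosh (b + l)) by (apply cosh_le; unfold b, l, c; nra).
  rewrite cosh_sub in Cs. rewrite cosh_add in Ca.
  assert (Sl : 0 < sinh l) by (rewrite <- sinh_0; now apply sinh_lt).
  assert (Sb : 0 <= sinh b) by now apply sinh_nonneg.
  pose proof (cosh_sq b) as Qb. pose proof (cosh_sq l) as Ql.
  pose proof (cosh_ge_1 b) as Gb. pose proof (cosh_ge_1 l) as Gl.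
  assert (El : exp l = cosh l + sinh l) by apply exp_cosh_sinh.
  (* Subtracting the distance equations [x^2 + y^2 + 1 = 2 y cosh b] and
     [x^2 + y^2 + exp (2 l) = 2 y exp l cosh c] eliminates [x] and leaves [y * D = sinh l]. *)
  set (D := cosh c - (cosh l - sinh l) * cosh b).
  assert (Hbs : sinh b < cosh b) by nra.
  assert (HD : 0 < D) by (unfold D; nra).
  set (y := sinh l / D).
  assert (Hy : 0 < y) by (unfold y; now apply Rdiv_lt_0_compat).
  assert (HyD : y * D = sinh l) by (unfold y; field; lra).
  (* the height [y] lies between [exp (-b)] and [exp b] *)
  assert (Hy1 : y <= cosh b + sinh b).
  { apply Rmult_le_reg_r with D; [exact HD|]. rewrite HyD. unfold D.
    assert ((cosh b + sinh b) * (cosh b * cosh l - sinh b * sinh l - (cosh l - sinh l) * cosh b) <=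
            (cosh b + sinh b) * (cosh c - (cosh l - sinh l) * cosh b))
      by (apply Rmult_le_compat_l; lra).
    replace ((cosh b + sinh b) * (cosh b * cosh l - sinh b * sinh l - (cosh l - sinh l) * cosh b))
      with (sinh l * (cosh b * cosh b - sinh b * sinh b)) in H by ring. nra. }
  assert (Hy2 : cosh b - sinh b <= y).
  { apply Rmult_le_reg_r with D; [exact HD|]. rewrite HyD. unfold D.
    assert ((cosh b - sinh b) * (cosh c - (cosh l - sinh l) * cosh b) <=
            (cosh b - sinh b) * (cosh b * cosh l + sinh b * sinh l - (cosh l - sinh l) * cosh b))
      by (apply Rmult_le_compat_l; lra).
    replace ((cosh b - sinh b) * (cosh b * cosh l + sinh b * sinh l - (cosh l - sinh l) * cosh b))
      with (sinh l * (cosh b * cosh b - sinh b * sinh b)) in H by ring. nra. }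
  set (x := sqrt (2 * y * cosh b - y * y - 1)).
  assert (Hx : x * x = 2 * y * cosh b - y * y - 1) by (apply sqrt_sqrt; nra).
  assert (Vert : forall s s', 0 <= s' <= s ->
    (exp (q * s) - exp (q * s')) * (exp (q * s) - exp (q * s')) =
    (cosh (q * (s - s')) - 1) * (2 * exp (q * s) * exp (q * s'))).
  { intros s s' _. unfold cosh. replace (- (q * (s - s'))) with (q * s' + - (q * s)) by lra.
    replace (q * (s - s')) with (q * s + - (q * s')) by lra. rewrite !exp_plus.
    pose proof (exp_neg_mul (q * s)) as X1. pose proof (exp_neg_mul (q * s')) as X2.
    set (A := exp (q * s)) in *. set (B := exp (q * s')) in *.
    set (A' := exp (- (q * s))) in *. set (B' := exp (- (q * s'))) in *.
    replace (((A * B' + B * A') / 2 - 1) * (2 * A * B)) with (A * A * (B * B') + B * B * (A * A') - 2 * A * B) by field.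
    rewrite X1, X2. ring. }
  exists (0, 1), (0, exp l), (x, y). unfold straight_model_triangle.
  pose proof (exp_pos l) as Pl.
  assert (PA : model_d kappa (0, 1) (0, exp l) = L).
  { apply model_d_cosh_eq; simpl; try lra. fold q.
    pose proof (Vert L 0 ltac:(lra)) as V. rewrite Rmult_0_r, exp_0, Rminus_0_r in V. fold l in V |- *. nra. }
  split; [right; simpl; lra|]. split; [right; simpl; lra|]. split; [right; simpl; lra|].
  split; [exact PA|]. split; [|split; [|split]].
  - apply model_d_cosh_eq; simpl; try lra. fold q; fold c. rewrite El. rewrite El in Pl.
    replace ((0 - x) * (0 - x)) with (x * x) by ring. rewrite Hx.
    replace (cosh c) with (D + (cosh l - sinh l) * cosh b) by (unfold D; ring).
    assert (Z : (cosh l + sinh l) * (cosh l - sinh l) = 1) by nra.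
    replace ((D + (cosh l - sinh l) * cosh b - 1) * (2 * (cosh l + sinh l) * y)) with
      (2 * (cosh l + sinh l) * (y * D) + 2 * y * cosh b * ((cosh l + sinh l) * (cosh l - sinh l)) - 2 * (cosh l + sinh l) * y) by ring.
    rewrite Z, HyD. nra.
  - apply model_d_cosh_eq; simpl; try lra. fold q; fold b. nra.
  - apply model_d_cosh_eq; simpl; try lra. rewrite Rmult_0_r, cosh_0. ring.
  - intros tau Ht. set (s := tau * L). exists (0, exp (q * s)).
    assert (Hs : 0 <= s <= L) by (unfold s; nra).
    pose proof (exp_pos (q * s)) as Ps.
    pose proof (cosh_sq (q * s)) as Qs.
    assert (Es : exp (q * s) = cosh (q * s) + sinh (q * s)) by apply exp_cosh_sinh.
    (* [w] is the hyperbolic cosine of the rescaled distance from the axis point at height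
       [exp (q * s)] to [u]. *)
    set (w := (cosh (q * s) - sinh (q * s)) * cosh b + sinh (q * s) / y).
    assert (Key : (0 - x) * (0 - x) + (exp (q * s) - y) * (exp (q * s) - y) = (w - 1) * (2 * exp (q * s) * y)).
    { replace ((0 - x) * (0 - x)) with (x * x) by ring. rewrite Hx, Es. unfold w.
      replace (((cosh (q * s) - sinh (q * s)) * cosh b + sinh (q * s) / y - 1) * (2 * (cosh (q * s) + sinh (q * s)) * y))
        with (2 * y * cosh b * (cosh (q * s) * cosh (q * s) - sinh (q * s) * sinh (q * s)) + 2 * sinh (q * s) * (cosh (q * s) + sinh (q * s))
          - 2 * y * (cosh (q * s) + sinh (q * s))) by (field; lra).
      rewrite Qs. nra. }
    assert (W1 : 1 <= w).
    { destruct (Rle_dec 1 w) as [|n]; [assumption|].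
      assert (0 < (1 - w) * (exp (q * s) * y)) by (apply Rmult_lt_0_compat; [|apply Rmult_lt_0_compat]; lra).
      pose proof (Rle_0_sqr (0 - x)) as S1. pose proof (Rle_0_sqr (exp (q * s) - y)) as S2.
      unfold Rsqr in S1, S2. lra. }
    assert (GU : model_d kappa (0, exp (q * s)) (x, y) = arcosh w / q).
    { apply model_d_cosh; simpl; lra. }
    destruct (cosh_arcosh w W1) as [CA PA'].
    split; [|split].
    + assert (0 <= tau * L) by nra. unfold model_seg. rewrite PA. split; [right; simpl; lra|]. split.
      * apply model_d_cosh_eq; simpl; try lra. fold q. fold s.
        pose proof (Vert s 0 ltac:(lra)) as V. rewrite Rmult_0_r, exp_0, Rminus_0_r in V. nra.
      * apply model_d_cosh_eq; simpl; try lra; try nra. fold q.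
        pose proof (Vert L s ltac:(lra)) as V. replace ((1 - tau) * L) with (L - s) by (unfold s; ring).
        fold l in V. nra.
    + rewrite GU. apply Rmult_le_pos; [exact PA' | left; now apply Rinv_0_lt_compat].
    + rewrite GU, !SN, !MD. unfold incr. fold q l b c.
      replace (q * (arcosh w / q)) with (arcosh w) by (field; lra). rewrite CA. fold s.
      assert (Hw : sinh l * w = sinh l * (cosh (q * s) - sinh (q * s)) * cosh b + sinh (q * s) * D).
      { unfold w. rewrite <- HyD. field. lra. }
      unfold D in Hw.
      transitivity (1 / (q * - kappa) * (sinh l * w - sinh l * cosh (q * s) * cosh b)); [field; lra|].
      rewrite Hw. field. lra.
Qed.

Lemma model_triangle L r rho :
  0 < L -> 0 <= r -> 0 <= rho -> L <= r + rho -> r <= L + rho -> rho <= L + r ->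
  exists p a u, straight_model_triangle L r rho p a u.
Proof.
  destruct (Req_dec kappa 0); [now apply flat_model_triangle | now apply hyperbolic_model_triangle].
Qed.
End Md.

(** * First-order comparison along geodesics *)

Section Metric.
Context {X : Type} (d : X -> X -> R).
Hypothesis Hd : is_metric d.

Lemma metric_nonneg x y : 0 <= d x y.
Proof. apply Hd. Qed.

Lemma metric_self x : d x x = 0.
Proof. now apply Hd. Qed.

Lemma metric_zero x y : d x y = 0 -> x = y.
Proof. apply Hd. Qed.

Lemma metric_sym x y : d x y = d y x.
Proof. apply Hd. Qed.

Lemma metric_triangle x y z : d x z <= d x y + d y z.
Proof. apply Hd. Qed.

Lemma geodesic_from x y g t : geodesic d x y g -> 0 <= t <= 1 -> d x (g t) = t * d x y.
Proof.
  intros (E0 & _ & E) Ht. rewrite <- E0 at 1. rewrite E by lra. f_equal.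
  rewrite Rabs_left1; lra.
Qed.

Lemma geodesic_restrict x y g l r :
  geodesic d x y g -> 0 <= l <= 1 -> 0 <= r <= 1 -> l <= r ->
  geodesic d (g l) (g r) (fun s => g (l + s * (r - l))).
Proof.
  intros (E0 & E1 & E) Hl Hr Hlr. split; [f_equal; ring|]. split; [f_equal; ring|].
  intros s t Hs Ht. rewrite !E by nra.
  replace (l + s * (r - l) - (l + t * (r - l))) with ((s - t) * (r - l)) by ring.
  rewrite Rabs_mult, (Rabs_right (r - l)), (Rabs_left1 (l - r)) by lra. ring.
Qed.

(* Covers both curvature bounds: [rel] is [<=] for CAT and [>=] for CBB; [v] is the
   distance in the model triangle. *)
Lemma hinge (rel : R -> R -> Prop) kappa p a g u t :
  kappa <= 0 -> geodesic_space d ->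
  (forall V G V', geod_triangle d V G -> comparison_triangle kappa d V V' -> triangle_cmp rel kappa d G V') ->
  geodesic d p a g -> 0 < d p a -> 0 <= t <= 1 ->
  exists v, 0 <= v /\ rel (d u (g t)) v /\
    sn kappa (d p a) * (md kappa v - md kappa (d u p) - md kappa (t * d p a) * (1 - kappa * md kappa (d u p)))
    = sn kappa (t * d p a) * incr (- kappa) (md kappa (d u a)) (md kappa (d p a)) (md kappa (d u p)).
Proof.
  intros Hk Hgs Hcmp Hg HL Ht.
  destruct (model_triangle kappa Hk (d p a) (d u p) (d u a) HL (metric_nonneg _ _) (metric_nonneg _ _))
    as (p' & a' & u' & Pp & Pa & Pu & Dpa & Dau & Dup & Duu & Seg).
  { rewrite (metric_sym u p). apply metric_triangle. }
  { rewrite (metric_sym p a), Rplus_comm. apply metric_triangle. }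
  { rewrite Rplus_comm. apply metric_triangle. }
  destruct (Seg t Ht) as (g' & Sg & Pos & Eq).
  destruct (Hgs a u) as (g1 & Hg1). destruct (Hgs u p) as (g2 & Hg2).
  set (V := fun i => match i with 0%nat => p | 1%nat => a | _ => u end).
  set (V' := fun i => match i with 0%nat => p' | 1%nat => a' | _ => u' end).
  set (G := fun i => match i with 0%nat => g | 1%nat => g1 | _ => g2 end).
  assert (T : geod_triangle d V G).
  { intros i Hi. destruct i as [|[|[|i]]]; simpl; [assumption..|lia]. }
  assert (C : comparison_triangle kappa d V V').
  { intros i Hi. destruct i as [|[|[|i]]]; simpl; [| | |lia]; split; auto.
    now rewrite Dau, metric_sym. }
  exists (model_d kappa g' u'). split; [exact Pos|]. split; [|exact Eq].
  (* The third side starts at [u], so its parameter 0 turns the comparison of two sides into one of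
     a side with a vertex. *)
  assert (Q := Hcmp V G V' T C 0%nat 2%nat t 0 g' u' ltac:(lia) ltac:(lia) Ht ltac:(lra)).
  simpl in Q. destruct Hg2 as (E2 & _). rewrite E2, metric_sym in Q. apply Q; [exact Sg|].
  split; [exact Pu|]. rewrite Duu. split; ring.
Qed.

Lemma md_dist_nonneg kappa x y : kappa <= 0 -> 0 <= md kappa (d x y).
Proof. intros; now apply md_nonneg. Qed.

(** From [hinge] at the arc length [s] with [sn s = t * sn (d p a)]: the term
    [md s * (1 - kappa * md (d u p))] is nonnegative and only helps the lower bound. *)
Lemma CBB_step kappa p a t :
  kappa <= 0 -> CBB kappa d -> 0 <= t <= 1 ->
  exists p', d p p' <= t * sn kappa (d p a) /\
    forall u, md kappa (d u p) + t * incr (- kappa) (md kappa (d u a)) (md kappa (d p a)) (md kappa (d u p))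
      <= md kappa (d u p').
Proof.
  intros Hk [Hgs Hc] Ht.
  destruct (metric_nonneg p a) as [HL|HL].
  2:{ symmetry in HL. pose proof (metric_zero _ _ HL) as <-. exists p.
      rewrite metric_self, sn_0, md_0 by assumption. unfold incr. split; [lra|]. intros u. lra. }
  destruct (sn_fraction kappa Hk (d p a) t ltac:(lra) Ht) as (s & Hs & Es).
  destruct (Hgs p a) as (g & Hg).
  set (tau := s / d p a).
  assert (Etau : tau * d p a = s) by (unfold tau; field; lra).
  assert (Htau : 0 <= tau <= 1) by (split; apply Rmult_le_reg_r with (d p a); lra).
  exists (g tau). split.
  { rewrite (geodesic_from _ _ _ _ Hg Htau), Etau, <- Es. now apply sn_ge. }
  intros u. destruct (hinge Rge kappa p a g u tau Hk Hgs Hc Hg HL Htau) as (v & Hv & Rv & Eq).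
  rewrite Etau, Es in Eq.
  pose proof (md_le kappa Hk v (d u (g tau)) Hv ltac:(lra)).
  pose proof (md_dist_nonneg kappa u p Hk). pose proof (md_nonneg kappa Hk s).
  assert (S0 : 0 < sn kappa (d p a)) by (rewrite <- (sn_0 kappa); now apply sn_lt).
  assert (Eq' : md kappa v - md kappa (d u p) - md kappa s * (1 - kappa * md kappa (d u p)) =
     t * incr (- kappa) (md kappa (d u a)) (md kappa (d p a)) (md kappa (d u p))).
  { apply Rmult_eq_reg_l with (sn kappa (d p a)); [|lra]. rewrite Eq. ring. }
  assert (0 <= md kappa s * (1 - kappa * md kappa (d u p))) by (apply Rmult_le_pos; nra).
  lra.
Qed.

(** Same argument as in [CBB_step], but here the extra term must be paid for: [md s <= sn(s)^2]
    makes it of order [t * t]. The new point is given on a geodesic so that convex sets retain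
    it. *)
Lemma CAT_step kappa p a t :
  kappa <= 0 -> CAT kappa d -> 0 <= t <= 1 ->
  exists g tau, geodesic d p a g /\ 0 <= tau <= 1 /\
    forall u, md kappa (d u (g tau)) <=
      md kappa (d u p) + t * incr (- kappa) (md kappa (d u a)) (md kappa (d p a)) (md kappa (d u p))
      + t * t * (md kappa (d p a) * (2 - kappa * md kappa (d p a)) * (1 - kappa * md kappa (d u p))).
Proof.
  intros Hk [Hgs Hc] Ht.
  destruct (Hgs p a) as (g & Hg). exists g.
  destruct (metric_nonneg p a) as [HL|HL].
  2:{ symmetry in HL. exists 0. split; [exact Hg|]. split; [lra|]. intros u.
      destruct Hg as (-> & _). pose proof (metric_zero _ _ HL) as <-.
      rewrite metric_self, md_0 by assumption. unfold incr. lra. }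
  destruct (sn_fraction kappa Hk (d p a) t ltac:(lra) Ht) as (s & Hs & Es).
  set (tau := s / d p a).
  assert (Etau : tau * d p a = s) by (unfold tau; field; lra).
  assert (Htau : 0 <= tau <= 1) by (split; apply Rmult_le_reg_r with (d p a); lra).
  exists tau. split; [exact Hg|]. split; [exact Htau|].
  intros u. destruct (hinge Rle kappa p a g u tau Hk Hgs Hc Hg HL Htau) as (v & Hv & Rv & Eq).
  rewrite Etau, Es in Eq.
  pose proof (md_le kappa Hk (d u (g tau)) v (metric_nonneg _ _) Rv).
  pose proof (md_dist_nonneg kappa u p Hk). pose proof (md_nonneg kappa Hk s).
  assert (S0 : 0 < sn kappa (d p a)) by (rewrite <- (sn_0 kappa); now apply sn_lt).
  assert (Eq' : md kappa v - md kappa (d u p) - md kappa s * (1 - kappa * md kappa (d u p)) =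
     t * incr (- kappa) (md kappa (d u a)) (md kappa (d p a)) (md kappa (d u p))).
  { apply Rmult_eq_reg_l with (sn kappa (d p a)); [|lra]. rewrite Eq. ring. }
  pose proof (sn_sq kappa Hk s) as Q1. pose proof (sn_sq kappa Hk (d p a)) as Q2. rewrite Es in Q1.
  assert (md kappa s <= t * t * (md kappa (d p a) * (2 - kappa * md kappa (d p a)))).
  { rewrite <- Q2. replace (t * t * (sn kappa (d p a) * sn kappa (d p a))) with (md kappa s * (2 - kappa * md kappa s)) by lra.
    nra. }
  assert (md kappa s * (1 - kappa * md kappa (d u p)) <=
    t * t * (md kappa (d p a) * (2 - kappa * md kappa (d p a))) * (1 - kappa * md kappa (d u p)))
    by (apply Rmult_le_compat_r; nra).
  lra.
Qed.

(* The Bruhat--Tits inequality for the modified distance. *)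
Lemma CAT_midpoint kappa p a g u :
  kappa <= 0 -> CAT kappa d -> geodesic d p a g ->
  (1 - kappa * md kappa (d p a / 2)) * md kappa (d u (g (1/2))) + md kappa (d p a / 2)
  <= (md kappa (d u p) + md kappa (d u a)) / 2.
Proof.
  intros Hk [Hgs Hc] Hg.
  destruct (metric_nonneg p a) as [HL|HL].
  2:{ assert (E := geodesic_from _ _ _ (1/2) Hg ltac:(lra)). rewrite <- HL, Rmult_0_r in E.
      apply metric_zero in E. rewrite <- E. symmetry in HL. pose proof (metric_zero _ _ HL) as <-.
      replace (d p p / 2) with 0 by lra. rewrite md_0 by assumption. lra. }
  destruct (hinge Rle kappa p a g u (1/2) Hk Hgs Hc Hg HL ltac:(lra)) as (v & Hv & Rv & Eq).
  pose proof (md_le kappa Hk (d u (g (1/2))) v (metric_nonneg _ _) Rv) as Hm.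
  assert (S0 : 0 < sn kappa (d p a / 2)) by (rewrite <- (sn_0 kappa); apply sn_lt; lra).
  replace (1 / 2 * d p a) with (d p a / 2) in Eq by lra.
  rewrite (sn_half kappa Hk) in Eq. unfold incr in Eq. rewrite (md_half kappa Hk (d p a)) in Eq.
  set (h := d p a / 2) in *. pose proof (md_nonneg kappa Hk h).
  assert (Eq' : 2 * (1 - kappa * md kappa h) * (md kappa v - md kappa (d u p) - md kappa h * (1 - kappa * md kappa (d u p))) =
    md kappa (d u a) - 2 * md kappa h * (2 - kappa * md kappa h) - md kappa (d u p) * (1 + - kappa * (2 * md kappa h * (2 - kappa * md kappa h)))).
  { apply Rmult_eq_reg_l with (sn kappa h); [|lra]. rewrite <- Eq. ring. }
  assert ((1 - kappa * md kappa h) * md kappa (d u (g (1/2))) <= (1 - kappa * md kappa h) * md kappa v)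
    by (apply Rmult_le_compat_l; nra).
  nra.
Qed.
End Metric.

(** * Finite sums over lists *)

Section ListSum.
Context {I : Type}.

Fixpoint lsum (f : I -> R) (l : list I) : R :=
  match l with nil => 0 | i :: l => f i + lsum f l end.

Lemma lsum_le f g l : (forall i, In i l -> f i <= g i) -> lsum f l <= lsum g l.
Proof.
  induction l as [|i l IH]; simpl; intros H; [lra|].
  apply Rplus_le_compat; [apply H; now left | apply IH; intros; apply H; now right].
Qed.

Lemma lsum_ext f g l : (forall i, In i l -> f i = g i) -> lsum f l = lsum g l.
Proof. intros H. apply Rle_antisym; apply lsum_le; intros i Hi; rewrite H; trivial; lra. Qed.

Lemma lsum_plus f g l : lsum (fun i => f i + g i) l = lsum f l + lsum g l.
Proof. induction l as [|i l IH]; simpl; [lra|]. rewrite IH; ring. Qed.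

Lemma lsum_minus f g l : lsum (fun i => f i - g i) l = lsum f l - lsum g l.
Proof. induction l as [|i l IH]; simpl; [lra|]. rewrite IH; ring. Qed.

Lemma lsum_scal c f l : lsum (fun i => c * f i) l = c * lsum f l.
Proof. induction l as [|i l IH]; simpl; [lra|]. rewrite IH; ring. Qed.

Lemma lsum_nonneg f l : (forall i, In i l -> 0 <= f i) -> 0 <= lsum f l.
Proof.
  intros H. transitivity (lsum (fun i => 0 * f i) l); [rewrite lsum_scal; lra|].
  apply lsum_le. intros i Hi. specialize (H i Hi). lra.
Qed.

Lemma lsum_const c l : lsum (fun _ => c) l = INR (length l) * c.
Proof. induction l as [|i l IH]; [simpl; lra|]. cbn [lsum length]. rewrite IH, S_INR. ring. Qed.
End ListSum.

Lemma lsum_map {I J} (g : I -> J) f l : lsum f (map g l) = lsum (fun i => f (g i)) l.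
Proof. induction l as [|i l IH]; simpl; [reflexivity|]. now rewrite IH. Qed.

Lemma lsum_swap {I J} (f : I -> J -> R) l l' :
  lsum (fun i => lsum (f i) l') l = lsum (fun j => lsum (fun i => f i j) l) l'.
Proof.
  induction l as [|i l IH]; simpl.
  - induction l' as [|j l' IH']; simpl; lra.
  - now rewrite IH, lsum_plus.
Qed.

(** * The Lang--Schroeder--Sturm inequality *)

Section Sturm.
Context {X : Type} (d : X -> X -> R) (kappa : R).
Hypothesis Hd : is_metric d.
Hypothesis Hk : kappa <= 0.
Hypothesis HX : CBB kappa d.

Let mu x y := md kappa (d x y).
Let dir p u a := incr (- kappa) (mu u a) (mu p a) (mu u p).
Let weight (l : list (R * X)) := lsum fst l.
Let var l u := lsum (fun i => fst i * mu u (snd i)) l.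
Let slope l p u := lsum (fun i => fst i * dir p u (snd i)) l.

(** Turns a gap in variance between [p] and [u] into a positive slope at [p], up to a term that is
    small when [u] is near [p]. *)
Lemma slope_var l p u : slope l p u = var l u - var l p - mu u p * (weight l - kappa * var l p).
Proof.
  unfold slope, var, weight. induction l as [|[w a] l IH]; simpl; [ring|].
  rewrite IH. unfold dir, incr. ring.
Qed.

Variables (p0 : X) (D : R).
Hypothesis HD : 0 <= D.

Let lip := sn kappa (2 * D).
(** A Lipschitz constant of [dir] in its base point: both distances to that point vary at rate
    [lip], and their product contributes two more terms with factor [- kappa * md kappa (2 * D)]. *)
Let dirlip := lip * (2 - 2 * kappa * md kappa (2 * D)).

Lemma lip_nonneg : 0 <= lip.
Proof. apply sn_nonneg; lra. Qed.

Lemma dirlip_nonneg : 0 <= dirlip.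
Proof.
  pose proof lip_nonneg. pose proof (md_nonneg kappa Hk (2 * D)).
  apply Rmult_le_pos; nra.
Qed.

Lemma ball_dist x y : d p0 x <= D -> d p0 y <= D -> 0 <= d x y <= 2 * D.
Proof.
  intros Hx Hy. split; [now apply metric_nonneg|].
  pose proof (metric_triangle d Hd x p0 y). rewrite (metric_sym d Hd x p0) in H. lra.
Qed.

Lemma mu_bounds x y : d p0 x <= D -> d p0 y <= D -> 0 <= mu x y <= md kappa (2 * D).
Proof.
  intros Hx Hy. pose proof (ball_dist x y Hx Hy). split; [now apply md_nonneg|].
  apply md_le; lra.
Qed.

Lemma mu_lipschitz u x y : d p0 u <= D -> d p0 x <= D -> d p0 y <= D -> mu u x <= mu u y + lip * d x y.
Proof.
  intros Hu Hx Hy.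
  pose proof (md_lipschitz kappa Hk (2 * D) (d u x) (d u y) (ball_dist u x Hu Hx) (ball_dist u y Hu Hy)).
  assert (Rabs (d u x - d u y) <= d x y).
  { pose proof (metric_triangle d Hd u x y). pose proof (metric_triangle d Hd u y x).
    rewrite (metric_sym d Hd y x) in H1. apply Rabs_le. lra. }
  pose proof lip_nonneg. unfold mu. fold lip in H. nra.
Qed.

Lemma mu_sym x y : mu x y = mu y x.
Proof. unfold mu. now rewrite (metric_sym d Hd x y). Qed.

Lemma dir_lipschitz p q u a :
  d p0 p <= D -> d p0 q <= D -> d p0 u <= D -> d p0 a <= D ->
  dir p u a <= dir q u a + dirlip * d p q.
Proof.
  intros Hp Hq Hu Ha. unfold dir, incr.
  pose proof (mu_lipschitz u q p Hu Hq Hp) as L1.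
  pose proof (mu_lipschitz a q p Ha Hq Hp) as L2.
  rewrite (mu_sym a q), (mu_sym a p) in L2. rewrite (metric_sym d Hd q p) in L1, L2.
  pose proof (mu_bounds u p Hu Hp) as B1. pose proof (mu_bounds q a Hq Ha) as B2.
  unfold dirlip. set (e := lip * d p q) in *. set (M := md kappa (2 * D)) in *.
  assert (0 <= e).
  { apply Rmult_le_pos; [apply lip_nonneg | now apply metric_nonneg]. }
  replace (lip * (2 - 2 * kappa * M) * d p q) with (e * (2 - 2 * kappa * M)) by (unfold e; ring).
  assert (mu u q * (1 - kappa * mu q a) <= (mu u p + e) * (1 - kappa * mu q a)) by (apply Rmult_le_compat_r; nra).
  assert (- kappa * (mu u p * mu q a) <= - kappa * (mu u p * (mu p a + e))).
  { apply Rmult_le_compat_l; [lra|]. apply Rmult_le_compat_l; lra. }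
  assert (e * (- kappa * mu q a) <= e * (- kappa * M)) by (apply Rmult_le_compat_l; nra).
  assert (e * (- kappa * mu u p) <= e * (- kappa * M)) by (apply Rmult_le_compat_l; nra).
  nra.
Qed.

Definition good_list (l : list (R * X)) := forall i, In i l -> 0 <= fst i /\ d p0 (snd i) <= D.

Lemma weight_nonneg l : good_list l -> 0 <= weight l.
Proof. intros H. apply lsum_nonneg. intros i Hi. apply (H i Hi). Qed.

Lemma slope_lipschitz l p q u :
  good_list l -> d p0 p <= D -> d p0 q <= D -> d p0 u <= D ->
  slope l p u <= slope l q u + weight l * (dirlip * d p q).
Proof.
  intros Hl Hp Hq Hu. unfold slope, weight. rewrite (Rmult_comm (lsum fst l)), <- lsum_scal, <- lsum_plus.
  apply lsum_le. intros i Hi. destruct (Hl i Hi) as [W A].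
  pose proof (dir_lipschitz p q u (snd i) Hp Hq Hu A). nra.
Qed.

(* [p'] is reached from [p] by moving a little towards each point of the list in turn;
   to first order this is a step towards the weighted barycentre. *)
Lemma block_step t l : good_list l -> 0 <= t -> forall p, t * weight l <= 1 ->
  d p0 p + t * weight l * lip <= D ->
  exists p', d p p' <= t * weight l * lip /\
    forall u, d p0 u <= D ->
      mu u p + t * slope l p u - dirlip * lip * (t * weight l * (t * weight l)) <= mu u p'.
Proof.
  intros Hl Ht. pose proof lip_nonneg as Hlip. pose proof dirlip_nonneg as Hdl.
  induction l as [|[w a] l IH]; intros p Hw Hp.
  - exists p. rewrite metric_self by assumption. unfold weight, slope; simpl. split; [lra|]. intros; lra.
  - assert (Hl' : good_list l) by (intros i Hi; apply Hl; now right).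
    destruct (Hl (w, a) (or_introl eq_refl)) as [W A]; simpl in W, A.
    pose proof (weight_nonneg l Hl') as Wl.
    change (weight ((w, a) :: l)) with (w + weight l) in *.
    assert (Tw : 0 <= t * w) by nra. assert (Tl : 0 <= t * weight l) by nra.
    assert (TL : 0 <= t * w * lip) by nra. assert (TL' : 0 <= t * weight l * lip) by nra.
    assert (Hp' : d p0 p <= D) by nra.
    destruct (CBB_step d Hd kappa p a (t * w) Hk HX ltac:(nra)) as (p1 & D1 & S1).
    assert (D1' : d p p1 <= t * w * lip).
    { assert (sn kappa (d p a) <= lip) by (apply sn_le; [assumption | now apply ball_dist]). nra. }
    pose proof (metric_triangle d Hd p0 p p1) as T1.
    assert (Hp1 : d p0 p1 <= D) by nra.
    destruct (IH Hl' p1 ltac:(nra) ltac:(nra)) as (p' & D2 & S2).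
    exists p'. split; [pose proof (metric_triangle d Hd p p1 p'); nra|].
    intros u Hu. specialize (S1 u). specialize (S2 u Hu).
    pose proof (slope_lipschitz l p p1 u Hl' Hp' Hp1 Hu) as SL.
    change (slope ((w, a) :: l) p u) with (w * dir p u a + slope l p u).
    fold (mu u p) (mu u a) (mu p a) (mu u p1) in S1. fold (dir p u a) in S1.
    (* Taking the remaining slopes at [p1] instead of [p] costs only second order in [t]. *)
    assert (t * slope l p u <= t * slope l p1 u + t * weight l * (dirlip * d p p1)) by nra.
    assert (t * weight l * (dirlip * d p p1) <= t * weight l * (dirlip * (t * w * lip))).
    { apply Rmult_le_compat_l; [lra|]. apply Rmult_le_compat_l; lra. }
    assert (0 <= dirlip * lip) by nra.
    assert (0 <= dirlip * lip * ((t * w) * (t * w) + (t * w) * (t * weight l))).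
    { apply Rmult_le_pos; [assumption|]. nra. }
    nra.
Qed.

(** The double sum of the Sturm inequality, which is also the rate at which a block step raises the
    variance. *)
Let total l p := lsum (fun i => fst i * slope l p (snd i)) l.

(* Each block step raises the variance at rate [c], so the endpoint [q] sees all earlier
   points at smaller variance and, by concavity, every block step moves away from [q]; but the
   walk ends at [q], so the accumulated decrease makes [mu q p] negative. *)
Lemma ascending_walk l t c r0 C L e :
  good_list l -> 0 < t -> r0 <= D -> 0 <= c ->
  L = weight l * lip -> e = dirlip * lip * (weight l * weight l) ->
  0 <= C -> (forall x, 0 <= x <= 2 * D -> md kappa x <= C * (x * x)) ->
  (forall p, d p0 p <= r0 -> c <= total l p) ->
  t * weight l <= 1 -> t * (weight l * e) <= c / 2 ->
  forall N p, d p0 p + INR N * t * L <= r0 ->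
    C * (L * L) * (weight l * (1 - kappa * md kappa (2 * D))) * (INR N * t) <= c / 4 ->
    exists q, d p q <= INR N * t * L /\ var l p + INR N * (t * (c / 2)) <= var l q /\
      mu q p <= - (t * t * (c * INR N * (INR N + 1) / 8 - INR N * e)).
Proof.
  intros Hl Ht Hr0 Hc EL Ee HC Quad Htot Tw Te.
  pose proof lip_nonneg as Hlip. pose proof dirlip_nonneg as Hdl. pose proof (weight_nonneg l Hl) as W.
  assert (HL : 0 <= L) by (rewrite EL; nra).
  pose proof (md_nonneg kappa Hk (2 * D)) as Hm.
  induction N as [|N IH]; intros p Hp Hs.
  - exists p. simpl. rewrite metric_self by assumption. unfold mu. rewrite metric_self, md_0 by assumption.
    split; [lra|]. split; lra.
  - rewrite S_INR in Hp, Hs |- *. pose proof (pos_INR N) as HN. set (n := INR N) in *.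
    assert (Ht' : 0 <= n * t) by nra. assert (HtL : 0 <= t * L) by nra. assert (HntL : 0 <= n * t * L) by nra.
    destruct (block_step t l Hl ltac:(lra) p Tw) as (p1 & D1 & S1).
    { rewrite Rmult_assoc, <- EL. nra. }
    rewrite Rmult_assoc, <- EL in D1.
    set (Z := C * (L * L) * (weight l * (1 - kappa * md kappa (2 * D)))) in *.
    assert (HZ : 0 <= Z).
    { apply Rmult_le_pos; [apply Rmult_le_pos; [lra|nra] | apply Rmult_le_pos; nra]. }
    pose proof (metric_triangle d Hd p0 p p1) as T1.
    destruct (IH p1 ltac:(nra) ltac:(nra)) as (q & D2 & V2 & M2).
    pose proof (metric_triangle d Hd p p1 q) as T2. pose proof (metric_triangle d Hd p0 p q) as T3.
    exists q.
    assert (Dq : d p q <= (n + 1) * t * L) by nra.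
    assert (Hp0 : d p0 p <= D) by nra. assert (Hq0 : d p0 q <= D) by nra.
    assert (Ee' : dirlip * lip * (t * weight l * (t * weight l)) = t * t * e) by (rewrite Ee; ring).
    rewrite Ee' in S1.
    (* The block step is tested against each point of the list and the results are averaged; [Te]
       keeps the error below half of the gain [t * c]. *)
    assert (V1 : var l p + t * (c / 2) <= var l p1).
    { assert (var l p + t * total l p - weight l * (t * t * e) <= var l p1).
      { unfold var, total, weight.
        replace (lsum (fun i => fst i * mu p (snd i)) l + t * lsum (fun i => fst i * slope l p (snd i)) l - lsum fst l * (t * t * e))
          with (lsum (fun i => fst i * mu p (snd i)) l + (t * lsum (fun i => fst i * slope l p (snd i)) l + - (t * t * e) * lsum fst l)) by ring.
        rewrite <- !lsum_scal, <- !lsum_plus. apply lsum_le. intros i Hi. destruct (Hl i Hi) as [Wi Ai].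
        specialize (S1 (snd i) Ai). rewrite (mu_sym p), (mu_sym p1). nra. }
      specialize (Htot p ltac:(nra)).
      assert (t * c <= t * total l p) by nra.
      assert (weight l * (t * t * e) <= t * (c / 2)) by nra. lra. }
    split; [exact Dq|]. split; [nra|].
    (* Testing the first block step against the final endpoint: [slope_var] and the bounds below
       give slope at least [(n + 1) * t * (c / 4)]. Summed over the steps, this produces the factor
       [N (N + 1) / 8]. *)
    specialize (S1 q Hq0). rewrite slope_var in S1.
    assert (Vb : 0 <= var l p <= weight l * md kappa (2 * D)).
    { split.
      - apply lsum_nonneg. intros i Hi. destruct (Hl i Hi) as [Wi Ai].
        apply Rmult_le_pos; [exact Wi | now apply mu_bounds].
      - unfold var, weight. rewrite Rmult_comm, <- lsum_scal. apply lsum_le. intros i Hi.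
        destruct (Hl i Hi) as [Wi Ai]. pose proof (mu_bounds p (snd i) Hp0 Ai). nra. }
    assert (Mq : mu q p <= C * (((n + 1) * t * L) * ((n + 1) * t * L))).
    { assert (B := ball_dist p q Hp0 Hq0). unfold mu. rewrite (metric_sym d Hd q p).
      specialize (Quad (d p q) B).
      assert (d p q * d p q <= (n + 1) * t * L * ((n + 1) * t * L)) by (apply Rmult_le_compat; lra). nra. }
    pose proof (mu_bounds q p Hq0 Hp0) as Mb.
    assert (P1 : mu q p * (weight l - kappa * var l p) <= (n + 1) * t * (c / 4)).
    { apply Rle_trans with (C * (((n + 1) * t * L) * ((n + 1) * t * L)) * (weight l * (1 - kappa * md kappa (2 * D)))).
      - apply Rmult_le_compat; [lra | nra | exact Mq | nra].
      - replace (C * (((n + 1) * t * L) * ((n + 1) * t * L)) * (weight l * (1 - kappa * md kappa (2 * D))))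
          with ((n + 1) * t * (Z * ((n + 1) * t))) by (unfold Z; ring).
        apply Rmult_le_compat_l; nra. }
    assert (t * (var l q - var l p - mu q p * (weight l - kappa * var l p)) >= t * ((n + 1) * t * (c / 4))) by nra.
    nra.
Qed.

(** A positive value would persist near [p0], and [ascending_walk] would apply there. With the
    duration [/ s] of the walk fixed and the number of steps large, its bound on [mu q p0] is
    negative. *)
Lemma total_nonpos l : good_list l -> 1 <= D -> total l p0 <= 0.
Proof.
  intros Hl D1. apply Rnot_lt_le. intros Hpos.
  set (c := total l p0 / 2). assert (Hc : 0 < c) by (unfold c; lra).
  pose proof lip_nonneg as Hlip. pose proof dirlip_nonneg as Hdl. pose proof (weight_nonneg l Hl) as W.
  pose proof (md_nonneg kappa Hk (2 * D)) as Hm.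
  set (Q := weight l * (weight l * dirlip)).
  assert (HQ : 0 <= Q) by (apply Rmult_le_pos; [|apply Rmult_le_pos]; lra).
  (* [Q] is a Lipschitz constant of [total l] in the base point, so at most [c], half of the initial
     value, is lost within radius [r0]. *)
  set (r0 := Rmin 1 (c / (Q + 1))).
  assert (Hr0 : 0 < r0) by (apply Rmin_glb_lt; [lra | apply Rdiv_lt_0_compat; lra]).
  assert (Hr1 : r0 <= 1) by apply Rmin_l.
  assert (Hr2 : Q * r0 <= c).
  { assert (r0 <= c / (Q + 1)) by apply Rmin_r.
    assert (r0 * (Q + 1) <= c).
    { apply Rmult_le_reg_r with (/ (Q + 1)); [apply Rinv_0_lt_compat; lra|].
      replace (r0 * (Q + 1) * / (Q + 1)) with r0 by (field; lra). exact H. }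
    nra. }
  assert (Hp00 : d p0 p0 <= D) by (rewrite metric_self by assumption; lra).
  assert (Htot : forall p, d p0 p <= r0 -> c <= total l p).
  { intros p Hp. assert (total l p0 <= total l p + Q * d p0 p).
    { unfold total, Q. rewrite <- (Rmult_comm (weight l * dirlip)), Rmult_assoc, (Rmult_comm (weight l * dirlip)).
      unfold weight at 1. rewrite (Rmult_comm (lsum fst l)).
      replace (lsum (fun i => fst i * slope l p (snd i)) l + d p0 p * lsum fst l * (weight l * dirlip))
        with (lsum (fun i => fst i * slope l p (snd i)) l + (weight l * (dirlip * d p0 p)) * lsum fst l) by ring.
      rewrite <- lsum_scal, <- lsum_plus. apply lsum_le. intros i Hi. destruct (Hl i Hi) as [Wi Ai].
      pose proof (slope_lipschitz l p0 p (snd i) Hl Hp00 ltac:(lra) Ai). nra. }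
    assert (Q * d p0 p <= Q * r0) by nra. unfold c in *. lra. }
  destruct (md_quadratic kappa Hk (2 * D) ltac:(lra)) as (C & HC & Quad).
  set (L := weight l * lip). set (e := dirlip * lip * (weight l * weight l)).
  assert (HL : 0 <= L) by (unfold L; nra).
  assert (He : 0 <= e) by (apply Rmult_le_pos; apply Rmult_le_pos; lra).
  set (Z := C * (L * L) * (weight l * (1 - kappa * md kappa (2 * D)))).
  assert (HZ : 0 <= Z) by (apply Rmult_le_pos; [apply Rmult_le_pos; [lra|nra] | apply Rmult_le_pos; nra]).
  (* Each summand secures one hypothesis of [ascending_walk] for duration [/ s]: staying within
     [r0], the quadratic bound, [t * weight l <= 1], and the error below [c / 2]. *)
  set (s := 1 + L / r0 + 4 * Z / c + weight l + 2 * (weight l * e) / c).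
  assert (A1 : 0 <= L / r0) by (apply Rmult_le_pos; [lra | left; now apply Rinv_0_lt_compat]).
  assert (A2 : 0 <= 4 * Z / c) by (apply Rmult_le_pos; [lra | left; now apply Rinv_0_lt_compat]).
  assert (A3 : 0 <= 2 * (weight l * e) / c) by (apply Rmult_le_pos; [nra | left; now apply Rinv_0_lt_compat]).
  assert (Hs : 0 < s) by (unfold s; lra).
  assert (Th : forall x y, 0 < y -> 0 <= x / y -> x / y <= s -> / s * x <= y).
  { intros x y Hy _ Hxy. apply Rmult_le_reg_l with (s / y); [now apply Rdiv_lt_0_compat|].
    replace (s / y * (/ s * x)) with (x / y) by (field; lra).
    replace (s / y * y) with s by (field; lra). exact Hxy. }
  (* Enough steps for [c * (n + 1) / 8] to exceed [e]; the successor keeps [n] away from 0. *)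
  destruct (INR_archimed 1 (8 * e / c) ltac:(lra)) as (N & HN).
  rewrite Rmult_1_r in HN.
  set (n := INR (S N)).
  assert (Hn : 1 <= n) by (unfold n; rewrite S_INR; pose proof (pos_INR N); lra).
  set (t := / s / n).
  assert (Hsi : 0 < / s) by now apply Rinv_0_lt_compat.
  assert (Ht : 0 < t) by (unfold t; apply Rdiv_lt_0_compat; lra).
  assert (Hnt : n * t = / s) by (unfold t; field; lra).
  assert (Hts : t <= / s) by nra.
  destruct (ascending_walk l t c r0 C L e Hl Ht ltac:(lra) ltac:(lra) eq_refl eq_refl HC Quad Htot) with (N := S N) (p := p0)
    as (q & _ & _ & M).
  - apply Rle_trans with (/ s * weight l); [nra|]. apply (Th _ 1); unfold s; lra.
  - apply Rle_trans with (/ s * (weight l * e)); [apply Rmult_le_compat_r; nra|].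
    assert (E : weight l * e / (c / 2) = 2 * (weight l * e) / c) by (field; lra).
    apply Th; [lra | rewrite E; lra | rewrite E; unfold s; lra].
  - rewrite metric_self by assumption. fold n. rewrite Hnt, Rplus_0_l. apply Th; unfold s; lra.
  - fold n. rewrite Hnt. fold Z. rewrite Rmult_comm.
    assert (E : Z / (c / 4) = 4 * Z / c) by (field; lra).
    apply Th; [lra | rewrite E; lra | rewrite E; unfold s; lra].
  - fold n in M. assert (0 <= mu q p0) by now apply md_nonneg.
    assert (8 * e < c * (n + 1)).
    { replace (8 * e) with (8 * e / c * c) by (field; lra). unfold n. rewrite S_INR. nra. }
    assert (0 < t * t * (n * (c * (n + 1) / 8 - e))).
    { apply Rmult_lt_0_compat; [nra|]. apply Rmult_lt_0_compat; lra. }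
    nra.
Qed.
End Sturm.

Lemma sturm_inequality {X : Type} (d : X -> X -> R) kappa p (l : list (R * X)) :
  is_metric d -> kappa <= 0 -> CBB kappa d -> (forall i, In i l -> 0 <= fst i) ->
  lsum (fun i => lsum (fun j => fst i * fst j *
    incr (- kappa) (md kappa (d (snd i) (snd j))) (md kappa (d p (snd j))) (md kappa (d (snd i) p))) l) l <= 0.
Proof.
  intros Hd Hk HX Hl.
  (* A ball of this radius about [p] contains all points of the list; the summand 1 provides
     [1 <= D]. *)
  set (D := 1 + lsum (fun i => d p (snd i)) l).
  assert (Hs : 0 <= lsum (fun i => d p (snd i)) l) by (apply lsum_nonneg; intros; now apply metric_nonneg).
  assert (G : good_list d p D l).
  { intros i Hi. split; [now apply Hl|]. unfold D. clear - Hi Hd.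
    induction l as [|j l IH]; simpl in *; [contradiction|].
    pose proof (metric_nonneg d Hd p (snd j)).
    assert (0 <= lsum (fun i => d p (snd i)) l) by (apply lsum_nonneg; intros; now apply metric_nonneg).
    destruct Hi as [-> |Hi]; [lra|]. specialize (IH Hi). lra. }
  pose proof (total_nonpos d kappa Hd Hk HX p D ltac:(unfold D; lra) l G ltac:(unfold D; lra)) as T.
  eapply Rle_trans; [|exact T]. apply lsum_le. intros i _.
  rewrite <- lsum_scal. apply lsum_le. intros j _. lra.
Qed.

(** * Convexity in CAT spaces *)

Lemma functional_choice {A B} (P : A -> B -> Prop) :
  (forall a, exists b, P a b) -> exists f, forall a, P a (f a).
Proof.
  intros H. exists (fun a => proj1_sig (constructive_indefinite_description _ (H a))).
  intros a. apply proj2_sig.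
Qed.

(** For negative curvature this is the product of [cosh z - cosh (x - y)] and
    [cosh (x + y) - cosh z], with rescaled arguments, in polynomial form. The factor [- kappa] makes
    the flat case trivial. *)
Lemma md_triangle kappa x y z :
  kappa <= 0 -> 0 <= x -> 0 <= y -> 0 <= z -> x <= y + z -> y <= x + z -> z <= x + y ->
  let X := md kappa x in let Y := md kappa y in let Z := md kappa z in
  - kappa * ((X - Y) * (X - Y) + Z * Z - 2 * Z * (X + Y) + 2 * kappa * X * Y * Z) <= 0.
Proof.
  intros Hk Hx Hy Hz T1 T2 T3 X Y Z.
  destruct (Req_dec kappa 0) as [e|e]; [rewrite e; lra|].
  destruct (sqrt_neg_pos kappa Hk e) as [Hq _].
  unfold X, Y, Z, md. destruct Req_EM_T as [|_]; [contradiction|].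
  set (q := sqrt (- kappa)) in *.
  assert (C1 : cosh (q * x - q * y) <= cosh (q * z)).
  { destruct (Rle_dec y x); [|rewrite <- cosh_neg]; apply cosh_le; nra. }
  assert (C2 : cosh (q * z) <= cosh (q * x + q * y)) by (apply cosh_le; nra).
  rewrite cosh_sub in C1. rewrite cosh_add in C2.
  pose proof (cosh_sq (q * x)) as Q1. pose proof (cosh_sq (q * y)) as Q2.
  set (A := cosh (q * x)) in *. set (B := cosh (q * y)) in *. set (C := cosh (q * z)) in *.
  set (S := sinh (q * x)) in *. set (T := sinh (q * y)) in *.
  assert (H : 0 <= (C - (A * B - S * T)) * (A * B + S * T - C)) by (apply Rmult_le_pos; lra).
  replace ((C - (A * B - S * T)) * (A * B + S * T - C))
    with ((S * S) * (T * T) - (C - A * B) * (C - A * B)) in H by ring.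
  replace (S * S) with (A * A - 1) in H by lra. replace (T * T) with (B * B - 1) in H by lra.
  match goal with |- ?e <= 0 =>
    replace e with (- (/ - kappa * ((A * A - 1) * (B * B - 1) - (C - A * B) * (C - A * B)))) by (field; lra) end.
  assert (0 < / - kappa) by (apply Rinv_0_lt_compat; lra). nra.
Qed.

Section Convex.
Context {Y : Type} (d : Y -> Y -> R).
Hypothesis Hd : is_metric d.

(** Closed convexity, reduced to midpoints because the Bruhat-Tits inequality speaks of midpoints
    only; [geodesic_in] recovers the other points. *)
Definition closed_midconvex (C : Y -> Prop) : Prop :=
  (forall y, closure d C y -> C y) /\
  (forall a b g, C a -> C b -> geodesic d a b g -> C (g (1/2))).

Lemma closed_midconvex_and C C' :
  closed_midconvex C -> closed_midconvex C' -> closed_midconvex (fun y => C y /\ C' y).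
Proof.
  intros [H1 H2] [H1' H2']. split.
  - intros y Hy. split; [apply H1 | apply H1']; intros eps He; destruct (Hy eps He) as (c & [] & ?); eauto.
  - intros a b g [] [] Hg. split; eauto.
Qed.

(** Bisection keeps both ends of an interval around [t] in [C]; closedness then catches the
    limit. *)
Lemma geodesic_in C a b g t :
  closed_midconvex C -> C a -> C b -> geodesic d a b g -> 0 <= t <= 1 -> C (g t).
Proof.
  intros [Hc Hm] Ha Hb Hg Ht.
  assert (Bis : forall n, exists l r, 0 <= l <= t /\ t <= r <= 1 /\ r - l = (1/2) ^ n /\ C (g l) /\ C (g r)).
  { induction n as [|n (l & r & Hl & Hr & E & Cl & Cr)].
    - exists 0, 1. destruct Hg as (-> & -> & _). simpl. repeat split; trivial; lra.
    - assert (Cm : C (g (l + 1 / 2 * (r - l)))).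
      { apply (Hm (g l) (g r) (fun s => g (l + s * (r - l)))); trivial.
        apply (geodesic_restrict d a b); trivial; lra. }
      replace (l + 1 / 2 * (r - l)) with ((l + r) / 2) in Cm by field.
      destruct (Rle_dec t ((l + r) / 2)).
      + exists l, ((l + r) / 2). simpl. rewrite <- E. repeat split; trivial; lra.
      + exists ((l + r) / 2), r. simpl. rewrite <- E. repeat split; trivial; lra. }
  apply Hc. intros eps He. pose proof (metric_nonneg d Hd a b) as Hab.
  destruct (pow_lt_1_zero (1/2) ltac:(rewrite Rabs_right; lra) (eps / (d a b + 1))) as (N & HN).
  { apply Rdiv_lt_0_compat; lra. }
  destruct (Bis N) as (l & r & Hl & Hr & E & Cl & _). exists (g l). split; [exact Cl|].
  destruct Hg as (_ & _ & Hg). rewrite Hg by lra. rewrite Rabs_right by lra.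
  specialize (HN N (le_n N)). rewrite Rabs_right in HN by lra.
  assert (t - l < eps / (d a b + 1)) by lra.
  assert ((t - l) * (d a b + 1) < eps).
  { replace eps with (eps / (d a b + 1) * (d a b + 1)) by (field; lra). apply Rmult_lt_compat_r; lra. }
  nra.
Qed.

Lemma geodesic_reverse a b g : geodesic d a b g -> geodesic d b a (fun s => g (1 - s)).
Proof.
  intros (E0 & E1 & E). split; [now rewrite Rminus_0_r|]. split; [now rewrite Rminus_diag|].
  intros s t Hs Ht. rewrite E by lra. rewrite (metric_sym d Hd b a). f_equal.
  replace (1 - s - (1 - t)) with (- (s - t)) by ring. apply Rabs_Ropp.
Qed.

Variable kappa : R.
Hypothesis Hk : kappa <= 0.
Hypothesis HY : CAT kappa d.

Let mu x y := md kappa (d x y).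

Lemma md_ball_closed_midconvex c M : closed_midconvex (fun y => mu c y <= M).
Proof.
  split.
  - intros y Hy. apply Rnot_lt_le. intros H.
    set (D := d c y + 1). pose proof (metric_nonneg d Hd c y) as Hcy.
    pose proof (sn_nonneg kappa Hk D ltac:(unfold D; lra)) as HL.
    set (eps := Rmin 1 ((mu c y - M) / (sn kappa D + 1))).
    assert (He : 0 < eps) by (apply Rmin_glb_lt; [lra | apply Rdiv_lt_0_compat; lra]).
    assert (He1 : eps <= 1) by apply Rmin_l.
    assert (He2 : sn kappa D * eps <= mu c y - M).
    { assert (E : eps <= (mu c y - M) / (sn kappa D + 1)) by apply Rmin_r.
      apply (Rmult_le_compat_r (sn kappa D + 1)) in E; [|lra].
      replace ((mu c y - M) / (sn kappa D + 1) * (sn kappa D + 1)) with (mu c y - M) in E by (field; lra). nra. }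
    destruct (Hy eps He) as (y' & Hy' & Hyy).
    pose proof (metric_triangle d Hd c y y') as T1. pose proof (metric_triangle d Hd c y' y) as T2.
    rewrite (metric_sym d Hd y' y) in T2. pose proof (metric_nonneg d Hd c y').
    pose proof (metric_nonneg d Hd y y').
    pose proof (md_lipschitz kappa Hk D (d c y) (d c y') ltac:(unfold D; lra) ltac:(unfold D; lra)) as L.
    assert (Rabs (d c y - d c y') <= d y y') by (apply Rabs_le; lra).
    fold (mu c y) (mu c y') in L.
    assert (sn kappa D * Rabs (d c y - d c y') < sn kappa D * eps \/ sn kappa D = 0) by (destruct HL as [HL|HL]; [left; apply Rmult_lt_compat_l; lra | now right]).
    destruct H3 as [H3|H3]; [lra|]. rewrite H3 in L. lra.
  - intros a b g Ha Hb Hg.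
    pose proof (CAT_midpoint d Hd kappa a b g c Hk HY Hg) as CN. fold (mu c (g (1/2))) (mu c a) (mu c b) in CN.
    pose proof (md_nonneg kappa Hk (d a b / 2)). pose proof (md_nonneg kappa Hk (d c (g (1/2)))) as Hg0.
    fold (mu c (g (1/2))) in Hg0.
    assert (0 <= - kappa * md kappa (d a b / 2) * mu c (g (1/2))) by (apply Rmult_le_pos; nra).
    cbv beta in *. lra.
Qed.

(** The Bruhat-Tits inequality is used for the side [a b] seen from [c], then for [a c] seen from
    the midpoint of [a b]. The curvature terms left over are those of [md_triangle] for the half
    lengths. *)
Lemma midpoint_contract a b c g h :
  geodesic d a b g -> geodesic d a c h -> d (g (1/2)) (h (1/2)) <= d b c / 2.
Proof.
  intros Hg Hh.
  pose proof (metric_nonneg d Hd a b) as Hab. pose proof (metric_nonneg d Hd a c) as Hac.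
  pose proof (metric_nonneg d Hd b c) as Hbc.
  apply (md_le_inv kappa Hk); [lra|].
  pose proof (CAT_midpoint d Hd kappa a b g c Hk HY Hg) as CN1.
  pose proof (CAT_midpoint d Hd kappa a c h (g (1/2)) Hk HY Hh) as CN2.
  rewrite (metric_sym d Hd (g (1/2)) a), (geodesic_from d a b g (1/2) Hg ltac:(lra)) in CN2.
  replace (1 / 2 * d a b) with (d a b / 2) in CN2 by lra.
  rewrite (metric_sym d Hd c a), (metric_sym d Hd c b), (metric_sym d Hd c (g (1/2))) in CN1.
  rewrite (md_half kappa Hk (d a c)), (md_half kappa Hk (d b c)) in CN1.
  assert (T : - kappa * ((md kappa (d a b / 2) - md kappa (d a c / 2)) * (md kappa (d a b / 2) - md kappa (d a c / 2))
     + md kappa (d b c / 2) * md kappa (d b c / 2) - 2 * md kappa (d b c / 2) * (md kappa (d a b / 2) + md kappa (d a c / 2))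
     + 2 * kappa * md kappa (d a b / 2) * md kappa (d a c / 2) * md kappa (d b c / 2)) <= 0).
  { apply md_triangle; try lra.
    - pose proof (metric_triangle d Hd a c b) as T. rewrite (metric_sym d Hd c b) in T. lra.
    - pose proof (metric_triangle d Hd a b c). lra.
    - pose proof (metric_triangle d Hd b a c) as T. rewrite (metric_sym d Hd b a) in T. lra. }
  pose proof (md_nonneg kappa Hk (d a b / 2)) as PA. pose proof (md_nonneg kappa Hk (d a c / 2)) as PB.
  pose proof (md_nonneg kappa Hk (d b c / 2)) as PC.
  pose proof (md_nonneg kappa Hk (d (g (1/2)) (h (1/2)))) as PT.
  set (A := md kappa (d a b / 2)) in *. set (B := md kappa (d a c / 2)) in *.
  set (C := md kappa (d b c / 2)) in *.
  set (P := md kappa (d (g (1/2)) c)) in *. set (U := md kappa (d (g (1/2)) (h (1/2)))) in *.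
  assert (0 <= - kappa * A) by nra. assert (0 <= - kappa * B) by nra.
  assert (M : (1 - kappa * A) * (2 * ((1 - kappa * B) * U + B)) <= (1 - kappa * A) * (A + P))
    by (apply Rmult_le_compat_l; lra).
  assert (F : ((1 - kappa * A) * (1 - kappa * B)) * U <= ((1 - kappa * A) * (1 - kappa * B)) * C) by nra.
  apply Rmult_le_reg_l in F; [exact F|]. apply Rmult_lt_0_compat; lra.
Qed.

(** Busemann convexity: the diagonal from [a] to [b'] splits the quadrilateral into two
    triangles. *)
Lemma midpoint_dist a b a' b' g g' :
  geodesic d a b g -> geodesic d a' b' g' -> d (g (1/2)) (g' (1/2)) <= (d a a' + d b b') / 2.
Proof.
  intros Hg Hg'. destruct (proj1 HY a b') as (j & Hj).
  pose proof (midpoint_contract _ _ _ _ _ Hg Hj) as M1.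
  pose proof (midpoint_contract _ _ _ _ _ (geodesic_reverse _ _ _ Hj) (geodesic_reverse _ _ _ Hg')) as M2.
  cbv beta in M2. replace (1 - 1 / 2) with (1 / 2) in M2 by lra.
  pose proof (metric_triangle d Hd (g (1/2)) (j (1/2)) (g' (1/2))). lra.
Qed.

(** The closed [delta]-neighbourhood of [C], phrased without an infimum; for [delta = 0] it is the
    closure. *)
Definition thickening (delta : R) (C : Y -> Prop) (y : Y) : Prop :=
  forall eps, 0 < eps -> exists c, C c /\ d y c < delta + eps.

Lemma thickening_closed_midconvex delta C :
  (forall a b g, C a -> C b -> geodesic d a b g -> C (g (1/2))) ->
  closed_midconvex (thickening delta C).
Proof.
  intros HC. split.
  - intros y Hy eps He. destruct (Hy (eps / 2) ltac:(lra)) as (y' & Hy' & Hyy).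
    destruct (Hy' (eps / 2) ltac:(lra)) as (c & Hc & Hyc). exists c. split; [exact Hc|].
    pose proof (metric_triangle d Hd y y' c). lra.
  - intros a b g Ha Hb Hg eps He.
    destruct (Ha eps He) as (a' & Ha' & Da). destruct (Hb eps He) as (b' & Hb' & Db).
    destruct (proj1 HY a' b') as (g' & Hg'). exists (g' (1/2)). split; [eauto|].
    pose proof (midpoint_dist _ _ _ _ _ _ Hg Hg'). lra.
Qed.

Lemma Gn_succ C n y : Gn d C n y -> Gn d C (S n) y.
Proof.
  intros H. destruct (proj1 HY y y) as (g & Hg). exists y, y, g, 0.
  split; [exact H|]. split; [exact H|]. split; [exact Hg|]. split; [lra|]. symmetry; apply Hg.
Qed.

Lemma Gn_le C n m y : (n <= m)%nat -> Gn d C n y -> Gn d C m y.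
Proof. induction 1 as [|m _ IH]; intros H; [exact H|]. apply Gn_succ. auto. Qed.

Lemma co_midconvex C a b g : co d C a -> co d C b -> geodesic d a b g -> co d C (g (1/2)).
Proof.
  intros (n & Hn) (m & Hm) Hg. exists (S (Nat.max n m)).
  exists a, b, g, (1/2). split; [apply (Gn_le C (S n)); [lia|exact Hn]|].
  split; [apply (Gn_le C (S m)); [lia|exact Hm]|]. split; [exact Hg|]. split; [lra|reflexivity].
Qed.

Lemma subset_co C y : C y -> co d C y.
Proof. intros H. exists 0%nat. now apply (Gn_succ C 0). Qed.

(** Applied with [K] a thickening, this transfers closeness of images to closeness of their closed
    hulls. *)
Lemma closed_co_least C K : closed_midconvex K -> (forall y, C y -> K y) -> forall y, closed_co d C y -> K y.
Proof.
  intros HK HC y Hy. apply HK. intros eps He. destruct (Hy eps He) as (c & (n & Hn) & Dc).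
  exists c. split; [|exact Dc]. revert c Hn Dc. generalize (S n). clear - HK HC Hd.
  assert (G : forall n c, Gn d C n c -> K c).
  { induction n as [|n IH]; simpl; [exact HC|].
    intros c (a & b & g & t & Ha & Hb & Hg & Ht & ->). apply (geodesic_in K a b); auto. }
  intros n c Hc _. now apply (G n).
Qed.

Lemma closed_co_closed_midconvex C : closed_midconvex (closed_co d C).
Proof.
  assert (E : forall y, closed_co d C y <-> thickening 0 (co d C) y).
  { intros y. split; intros H eps He; destruct (H eps He) as (c & Hc & Dc); exists c; (split; [exact Hc|lra]). }
  destruct (thickening_closed_midconvex 0 (co d C) (co_midconvex C)) as [H1 H2]. split.
  - intros y Hy. apply E, H1. intros eps He. destruct (Hy eps He) as (c & Hc & Dc).
    exists c. split; [now apply E | exact Dc].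
  - intros a b g Ha Hb Hg. apply E. apply (H2 a b); trivial; now apply E.
Qed.

Lemma co_subset_closed_co C y : co d C y -> closed_co d C y.
Proof. intros H eps He. exists y. now rewrite metric_self. Qed.

Hypothesis Hcomplete : complete d.

(* As in Hilbert space: points nearly minimising the distance to a base point over
   larger and larger finite intersections form a Cauchy sequence. *)
Lemma closed_midconvex_intersection (F : (Y -> Prop) -> Prop) (K0 : Y -> Prop) y0 M :
  (forall K, F K -> closed_midconvex K) -> F K0 -> (forall y, K0 y -> d y0 y <= M) ->
  (forall L, (forall K, In K L -> F K) -> exists y, forall K, In K L -> K y) ->
  exists z, forall K, F K -> K z.
Proof.
  intros HF HK0 HM Hfip.
  set (sub := fun L : list (Y -> Prop) => forall K, In K L -> F K).
  set (inter := fun (L : list (Y -> Prop)) y => forall K, In K L -> K y).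
  (* Lower bounds for [mu y0] on finite intersections. Their supremum [rho] is finite because
     adjoining [K0] yields a point within [M]. *)
  set (T := fun v => exists L, sub L /\ forall y, inter L y -> v <= mu y0 y).
  destruct (completeness T) as (rho & Hub & Hlub).
  { exists (md kappa M). intros v (L & HL & Hv).
    destruct (Hfip (K0 :: L)) as (y & Hy); [intros K [<- |HK]; auto|].
    transitivity (mu y0 y); [apply Hv; intros K HK; apply Hy; now right|].
    apply md_le; [assumption | now apply metric_nonneg |]. apply HM, Hy. now left. }
  { exists 0, nil. split; [intros K []|]. intros y _. now apply md_nonneg. }
  assert (Hin : forall n : nat, 0 < / (INR n + 1)) by (intros n; apply Rinv_0_lt_compat; pose proof (pos_INR n); lra).
  assert (Hlow : forall n : nat, exists L, sub L /\ forall y, inter L y -> rho - / (INR n + 1) <= mu y0 y).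
  { intros n. apply NNPP. intros H. specialize (Hin n).
    enough (rho <= rho - / (INR n + 1)) by lra. apply Hlub. intros v (L & HL & Hv).
    apply Rnot_lt_le. intros Hlt. apply H. exists L. split; [exact HL|].
    intros y Hy. specialize (Hv y Hy). lra. }
  assert (Hpt : forall L eta, sub L -> 0 < eta -> exists y, inter L y /\ mu y0 y < rho + eta).
  { intros L eta HL He. apply NNPP. intros H.
    enough (rho + eta <= rho) by lra. apply Hub. exists L. split; [exact HL|].
    intros y Hy. apply Rnot_lt_le. intros Hlt. apply H. eauto. }
  destruct (functional_choice _ Hlow) as (L & HL).
  (* Accumulating the subfamilies makes the intersections decrease, so all later points stay nearly
     optimal for the earlier ones. *)
  set (Cum := fix Cum n := match n with 0%nat => L 0%nat | S n => L (S n) ++ Cum n end).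
  assert (HCum : forall n, sub (Cum n)).
  { induction n; simpl; [apply HL|]. intros K HK. apply in_app_or in HK as [HK|HK]; [now apply (HL (S n)) | auto]. }
  assert (HCi : forall n m y, (m <= n)%nat -> inter (Cum n) y -> inter (L m) y).
  { intros n m y Hnm. induction n as [|n IH]; simpl.
    - replace m with 0%nat by lia. auto.
    - intros Hy. destruct (Nat.eq_dec m (S n)) as [->|].
      + intros K HK. apply Hy, in_or_app. now left.
      + apply IH; [lia|]. intros K HK. apply Hy, in_or_app. now right. }
  (* The midpoint also lies in the intersection, so its value is at least [rho - / (INR n + 1)].
     Bruhat-Tits leaves [md (d y y' / 2) <= 2 / (INR n + 1)], and [md_ge] gives the constant 16. *)
  assert (Close : forall n y y', inter (L n) y -> inter (L n) y' -> mu y0 y < rho + / (INR n + 1) ->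
    mu y0 y' < rho + / (INR n + 1) -> d y y' * d y y' <= 16 * / (INR n + 1)).
  { intros n y y' Hy Hy' B B'. destruct (proj1 HY y y') as (g & Hg).
    assert (Hw : inter (L n) (g (1/2))).
    { intros K HK. apply (HF K (proj1 (HL n) K HK)) with y y'; [now apply Hy | now apply Hy' | exact Hg]. }
    apply HL in Hw. pose proof (CAT_midpoint d Hd kappa y y' g y0 Hk HY Hg) as CN.
    fold (mu y0 (g (1/2))) (mu y0 y) (mu y0 y') in CN.
    pose proof (md_ge kappa Hk (d y y' / 2)). pose proof (md_nonneg kappa Hk (d y y' / 2)).
    assert (0 <= mu y0 (g (1/2))) by now apply md_nonneg.
    assert (0 <= - kappa * md kappa (d y y' / 2) * mu y0 (g (1/2))) by (apply Rmult_le_pos; nra). nra. }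
  assert (Hz : forall n, exists z, inter (Cum n) z /\ mu y0 z < rho + / (INR n + 1)) by (intros; apply Hpt; auto).
  destruct (functional_choice _ Hz) as (z & Pz).
  assert (Hdec : forall N n, (N <= n)%nat -> / (INR n + 1) <= / (INR N + 1)).
  { intros N n H. apply le_INR in H. pose proof (pos_INR N). apply Rinv_le_contravar; lra. }
  assert (Hsmall : forall eps, 0 < eps -> exists N, 16 * / (INR N + 1) < eps * eps).
  { intros eps He. destruct (INR_archimed (eps * eps) 16 ltac:(nra)) as (N & HN). exists N.
    pose proof (pos_INR N). apply Rmult_lt_reg_r with (INR N + 1); [lra|].
    replace (16 * / (INR N + 1) * (INR N + 1)) with 16 by (field; lra). nra. }
  assert (Lt : forall x eps, 0 < eps -> x * x < eps * eps -> x < eps).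
  { intros x eps He H. apply Rnot_le_lt. intros Hx.
    assert (eps * eps <= x * x) by (apply Rmult_le_compat; lra). lra. }
  destruct (Hcomplete z) as (lim & Hlim).
  { intros eps He. destruct (Hsmall eps He) as (N & HN). exists N. intros m n Hm Hn.
    apply Lt; [exact He|]. apply Rle_lt_trans with (2 := HN).
    apply Close; [apply (HCi m); [exact Hm | apply Pz] | apply (HCi n); [exact Hn | apply Pz] | |].
    - pose proof (proj2 (Pz m)). specialize (Hdec N m Hm). lra.
    - pose proof (proj2 (Pz n)). specialize (Hdec N n Hn). lra. }
  exists lim. intros K HK. apply (HF K HK). intros eps He.
  destruct (Hsmall (eps / 2) ltac:(lra)) as (N1 & HN1). destruct (Hlim (eps / 2) ltac:(lra)) as (N2 & HN2).
  set (N := Nat.max N1 N2).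
  (* A nearly minimal point that also lies in [K] is close to [z N] by [Close], hence close to the
     limit. *)
  destruct (Hpt (K :: Cum N) (/ (INR N + 1))) as (y & Hy & By); [|apply Hin|].
  { intros K1 [<- |HK1]; [exact HK|]. now apply (HCum N). }
  exists y. split; [apply Hy; now left|].
  assert (D1 : d y (z N) < eps / 2).
  { apply Lt; [lra|]. apply Rle_lt_trans with (2 := HN1).
    apply Rle_trans with (16 * / (INR N + 1)).
    - apply Close; [| apply (HCi N); [lia|apply Pz] | exact By | apply Pz].
      apply (HCi N); [lia|]. intros K' HK'. apply Hy. now right.
    - specialize (Hdec N1 N ltac:(lia)). lra. }
  specialize (HN2 N ltac:(lia)).
  pose proof (metric_triangle d Hd lim (z N) y) as T1.
  rewrite (metric_sym d Hd lim (z N)), (metric_sym d Hd (z N) y) in T1. lra.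
Qed.
End Convex.

(** * Intersections of balls *)

Section Balls.
Context {Y I : Type} (d : Y -> Y -> R) (kappa : R).
Hypothesis Hd : is_metric d.
Hypothesis Hk : kappa <= 0.
Hypothesis HY : CAT kappa d.

Let mu x y := md kappa (d x y).

Variables (Z : Y -> Prop) (P : I -> Prop) (c : I -> Y) (r : I -> R).
Hypothesis HZ : closed_midconvex d Z.
Hypothesis Hc : forall i, P i -> Z (c i).
Hypothesis Hr : forall i, P i -> 0 <= r i.
(** The Sturm form with the radii [r] replacing the modified distances to a centre still to be
    found. Repetitions in [l] act as integer weights. *)
Hypothesis Hsturm : forall l, (forall i, In i l -> P i) ->
  lsum (fun j => lsum (fun i => mu (c j) (c i) - r j - r i + kappa * r j * r i) l) l <= 0.

(* A discrete subgradient descent: step towards the centre of a violated ball. *)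
Lemma subgradient_walk l B M eps t :
  closed_midconvex d B -> (forall i, In i l -> P i /\ B (c i)) ->
  (forall u v, B u -> B v -> mu u v <= M) ->
  (forall y, B y -> exists i, In i l /\ r i + eps < mu (c i) y) ->
  0 <= eps -> 0 <= t <= 1 -> forall y0, B y0 -> forall N, exists y w, B y /\ length w = N /\
    (forall s, In s w -> B (fst s) /\ In (snd s) l) /\
    forall u, B u -> mu u y <= M +
      t * lsum (fun s => mu u (c (snd s)) - r (snd s) - eps - mu u (fst s) * (1 - kappa * r (snd s))) w
      + INR N * (t * t * (M * (2 - kappa * M) * (1 - kappa * M))).
Proof.
  intros HB Hl HM Hviol He Ht y0 Hy0. induction N as [|N (y & w & By & Lw & Hw & IH)].
  - exists y0, nil. split; [exact Hy0|]. split; [reflexivity|]. split; [intros s []|].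
    intros u Hu. simpl. specialize (HM u y0 Hu Hy0). lra.
  - destruct (Hviol y By) as (i & Hi & Vi). destruct (Hl i Hi) as [Pi Bi].
    destruct (CAT_step d Hd kappa y (c i) t Hk HY Ht) as (g & tau & Hg & Htau & S).
    exists (g tau), ((y, i) :: w).
    split; [now apply (geodesic_in d Hd B y (c i))|]. split; [simpl; now rewrite Lw|].
    split; [intros s [<- |Hs]; auto|].
    intros u Hu. specialize (S u). specialize (IH u Hu). rewrite S_INR. cbn [lsum fst snd].
    fold (mu u (g tau)) (mu u y) (mu u (c i)) (mu y (c i)) in S.
    assert (Eyc : mu y (c i) = mu (c i) y) by (unfold mu; now rewrite (metric_sym d Hd y (c i))).
    pose proof (md_nonneg kappa Hk (d u y)) as P1. fold (mu u y) in P1.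
    pose proof (md_nonneg kappa Hk (d y (c i))) as P2. fold (mu y (c i)) in P2.
    pose proof (HM u y Hu By) as M1. pose proof (HM y (c i) By Bi) as M2.
    assert (I1 : incr (- kappa) (mu u (c i)) (mu y (c i)) (mu u y)
      <= mu u (c i) - r i - eps - mu u y * (1 - kappa * r i)).
    { unfold incr. assert (mu u y * (- kappa * r i) <= mu u y * (- kappa * mu y (c i))); [|lra].
      apply Rmult_le_compat_l; [lra|]. nra. }
    assert (I2 : mu y (c i) * (2 - kappa * mu y (c i)) * (1 - kappa * mu u y) <= M * (2 - kappa * M) * (1 - kappa * M)).
    { apply Rmult_le_compat; [apply Rmult_le_pos; nra | nra | apply Rmult_le_compat; nra | nra]. }
    assert (0 <= t * t) by nra.
    apply (Rmult_le_compat_l t) in I1; [|lra].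
    apply (Rmult_le_compat_l (t * t)) in I2; [|lra]. lra.
Qed.

(** Testing at the visited points, weighted by [1 - kappa * r], and at the centres bounds the double
    sum of [mu] over centres from below by [n (S + n eps) + (S + n eps) (n - kappa S)]. [Hsturm]
    bounds it from above by [2 n S - kappa S^2], which is smaller. *)
Lemma violated_walk_absurd (B : Y -> Prop) eps w :
  0 < eps -> w <> nil -> (forall s, In s w -> B (fst s) /\ P (snd s) /\ B (c (snd s))) ->
  ~ (forall u, B u -> lsum (fun s => r (snd s)) w + INR (length w) * eps
       + lsum (fun s => mu u (fst s) * (1 - kappa * r (snd s))) w <= lsum (fun s => mu u (c (snd s))) w).
Proof.
  intros He Hw HB Hu.
  set (S := lsum (fun s => r (snd s)) w) in *. set (n := INR (length w)) in *.
  assert (Hn : 0 < n).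
  { destruct w; [contradiction|]. unfold n. apply lt_0_INR. simpl; lia. }
  assert (HS : 0 <= S) by (apply lsum_nonneg; intros s Hs; apply Hr, (HB s Hs)).
  assert (H1 : n * (S + n * eps) + lsum (fun s => (S + n * eps) * (1 - kappa * r (snd s))) w
    <= lsum (fun s' => lsum (fun s => mu (c (snd s')) (c (snd s))) w) w).
  { apply Rle_trans with (lsum (fun s' => (S + n * eps) +
      lsum (fun s => mu (c (snd s')) (fst s) * (1 - kappa * r (snd s))) w) w).
    - rewrite (lsum_plus (fun _ => S + n * eps)), lsum_const. fold n.
      apply Rplus_le_compat_l. rewrite lsum_swap. apply lsum_le. intros s Hs.
      destruct (HB s Hs) as (B1 & P1 & _). pose proof (Hr _ P1) as Hr1.
      apply Rle_trans with (lsum (fun s' => (1 - kappa * r (snd s)) * mu (fst s) (c (snd s'))) w).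
      + rewrite lsum_scal, (Rmult_comm (S + n * eps)). apply Rmult_le_compat_l; [nra|].
        specialize (Hu _ B1).
        assert (0 <= lsum (fun s0 => mu (fst s) (fst s0) * (1 - kappa * r (snd s0))) w); [|lra].
        apply lsum_nonneg. intros s0 Hs0. apply Rmult_le_pos; [now apply md_nonneg|].
        pose proof (Hr _ (proj1 (proj2 (HB s0 Hs0)))). nra.
      + apply lsum_le. intros s' _. unfold mu. rewrite (metric_sym d Hd (fst s)). lra.
    - apply lsum_le. intros s' Hs'. apply Hu. now apply HB. }
  rewrite lsum_scal in H1.
  assert (E1 : lsum (fun s : Y * I => 1 - kappa * r (snd s)) w = n - kappa * S).
  { rewrite (lsum_minus (fun _ => 1)), lsum_const, lsum_scal. fold n S. ring. }
  rewrite E1 in H1.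
  pose proof (Hsturm (map snd w)) as St. rewrite lsum_map in St.
  assert (H2 : lsum (fun s' => lsum (fun s => mu (c (snd s')) (c (snd s))) w) w - 2 * n * S + kappa * S * S <= 0).
  { eapply Rle_trans; [|apply St].
    - right. transitivity (lsum (fun s' => lsum (fun s => mu (c (snd s')) (c (snd s))) w - n * r (snd s') - S
        + kappa * S * r (snd s')) w).
      + rewrite lsum_plus, lsum_minus, lsum_minus, lsum_const, !lsum_scal. fold n S. ring.
      + apply lsum_ext. intros s' _. rewrite lsum_map.
        rewrite lsum_plus, lsum_minus, lsum_minus, lsum_const, lsum_scal. fold n S. ring.
    - intros i Hi. apply in_map_iff in Hi as (s & <- & Hs). now apply HB. }
  assert (0 < n * (n * eps)) by (apply Rmult_lt_0_compat; [|apply Rmult_lt_0_compat]; lra).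
  assert (0 <= - kappa * S * (n * eps)) by (apply Rmult_le_pos; nra). nra.
Qed.

(** If every point of [Z] violated some ball, a long walk of small steps would satisfy the
    inequality refuted by [violated_walk_absurd]. *)
Lemma balls_finite_intersection l eps :
  (exists y, Z y) -> (forall i, In i l -> P i) -> 0 < eps ->
  exists y, Z y /\ forall i, In i l -> mu (c i) y <= r i + eps.
Proof.
  intros [z0 Hz0] Hl He. destruct l as [|i0 l0]; [exists z0; split; [exact Hz0 | intros i []]|].
  set (l := i0 :: l0) in *. set (c0 := c i0).
  apply NNPP. intros Habs.
  set (D := lsum (fun i => d c0 (c i)) l).
  assert (HD : forall i, In i l -> d c0 (c i) <= D).
  { unfold D. generalize l. intros l1. induction l1 as [|j l1 IH]; intros i; [intros []|]. simpl.
    pose proof (metric_nonneg d Hd c0 (c j)).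
    assert (0 <= lsum (fun i => d c0 (c i)) l1) by (apply lsum_nonneg; intros; now apply metric_nonneg).
    intros [-> |Hi]; [lra|]. specialize (IH i Hi). lra. }
  assert (HD0 : 0 <= D) by (apply lsum_nonneg; intros; now apply metric_nonneg).
  (* A bounded convex set containing all the centres: the walk never leaves it, and [M] bounds all
     modified distances. *)
  set (B := fun y => Z y /\ mu c0 y <= md kappa D).
  assert (HB : closed_midconvex d B).
  { apply closed_midconvex_and; [exact HZ | now apply md_ball_closed_midconvex]. }
  assert (HlB : forall i, In i l -> P i /\ B (c i)).
  { intros i Hi. split; [auto|]. split; [auto|]. apply md_le; [assumption | now apply metric_nonneg | auto]. }
  set (M := md kappa (2 * D)).
  assert (HM : forall u v, B u -> B v -> mu u v <= M).
  { intros u v [_ Hu] [_ Hv]. apply md_le_inv in Hu, Hv; trivial.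
    apply md_le; [assumption | now apply metric_nonneg|].
    pose proof (metric_triangle d Hd u c0 v) as T. rewrite (metric_sym d Hd u c0) in T. lra. }
  assert (Hviol : forall y, B y -> exists i, In i l /\ r i + eps < mu (c i) y).
  { intros y [Hy _]. apply NNPP. intros H. apply Habs. exists y. split; [exact Hy|].
    intros i Hi. apply Rnot_lt_le. intros Hlt. apply H. eauto. }
  pose proof (md_nonneg kappa Hk (2 * D)) as HM0. fold M in HM0.
  set (Q := M * (2 - kappa * M) * (1 - kappa * M)).
  assert (HQ : 0 <= Q) by (apply Rmult_le_pos; [apply Rmult_le_pos|]; nra).
  (* Of each violation [eps], a quarter pays for the second-order errors, a quarter (over [N] steps)
     for the initial bound [M], and half remains for the contradiction. *)
  set (t := eps / (eps + 4 * Q)).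
  assert (Ht0 : 0 < t) by (apply Rdiv_lt_0_compat; lra).
  assert (Ht : t * (eps + 4 * Q) = eps) by (unfold t; field; lra).
  assert (Ht1 : t <= 1) by nra.
  assert (HtQ : t * Q <= eps / 4) by nra.
  destruct (INR_archimed (t * (eps / 4)) M ltac:(nra)) as (N0 & HN0).
  set (N := S N0).
  assert (HN : M <= INR N * (t * (eps / 4))) by (unfold N; rewrite S_INR; nra).
  destruct (subgradient_walk l B M eps t HB HlB HM Hviol ltac:(lra) ltac:(lra) c0 (proj2 (HlB i0 (or_introl eq_refl))) N)
    as (y & w & By & Lw & Hw & Hu).
  fold Q in Hu.
  apply (violated_walk_absurd B (eps / 2) w).
  - lra.
  - intros ->. discriminate Lw.
  - intros s Hs. destruct (Hw s Hs) as [B1 B2]. specialize (HlB _ B2). tauto.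
  - intros u Bu. specialize (Hu u Bu). pose proof (md_nonneg kappa Hk (d u y)) as H0. fold (mu u y) in H0.
    rewrite !lsum_minus, lsum_const, Lw in Hu. rewrite Lw.
    match goal with |- ?a + ?b + ?e <= ?f => set (S1 := a) in *; set (S2 := e) in *; set (S3 := f) in * end.
    pose proof (pos_INR N) as HN'.
    assert (INR N * (t * t * Q) <= INR N * (t * (eps / 4))) by (apply Rmult_le_compat_l; nra).
    apply Rmult_le_reg_l with t; [exact Ht0|]. nra.
Qed.

Lemma balls_intersection :
  complete d -> (exists i, P i) -> exists y, Z y /\ forall i, P i -> mu (c i) y <= r i.
Proof.
  intros Hcomp (i0 & Hi0).
  set (ball := fun (e : R) i y => mu (c i) y <= r i + e).
  set (F := fun K => K = Z \/ exists i e, P i /\ 0 < e /\ K = ball e i).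
  (* The bound [r i0 + 2] follows from [md_ge], since [2 * (r + 1) <= (r + 2)^2]. *)
  destruct (closed_midconvex_intersection d Hd kappa Hk HY Hcomp F (ball 1 i0) (c i0) (r i0 + 2)) as (z & Hz).
  - intros K [-> |(i & e & _ & _ & ->)]; [exact HZ | now apply md_ball_closed_midconvex].
  - right. exists i0, 1. repeat split; trivial; lra.
  - intros y Hy. unfold ball, mu in Hy. pose proof (md_ge kappa Hk (d (c i0) y)). nra.
  - intros L HL.
    (* A finite subfamily of [F] is controlled by finitely many indices and the least of their
       enlargements. *)
    assert (G : exists l e, 0 < e /\ (forall i, In i l -> P i) /\
      forall y, Z y -> (forall i, In i l -> ball e i y) -> forall K, In K L -> K y).
    { induction L as [|K L IH].
      - exists nil, 1. split; [lra|]. split; [intros i []|]. intros y _ _ K [].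
      - destruct IH as (l & e & He & Hl & H); [intros; apply HL; now right|].
        destruct (HL K (or_introl eq_refl)) as [-> |(i & e' & Pi & He' & ->)].
        + exists l, e. split; [exact He|]. split; [exact Hl|].
          intros y Hy Hb K [<- |HK]; [exact Hy | exact (H y Hy Hb K HK)].
        + exists (i :: l), (Rmin e e'). split; [now apply Rmin_glb_lt|].
          split; [intros j [<- |Hj]; auto|].
          intros y Hy Hb K [<- |HK].
          * specialize (Hb i (or_introl eq_refl)). unfold ball in *. pose proof (Rmin_r e e'). lra.
          * apply (H y Hy); [|exact HK]. intros j Hj. specialize (Hb j (or_intror Hj)).
            unfold ball in *. pose proof (Rmin_l e e'). lra. }
    destruct G as (l & e & He & Hl & H).
    destruct (balls_finite_intersection l e) as (y & Hy & Hb); [eauto | exact Hl | exact He |].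
    exists y. now apply H.
  - exists z. split; [apply Hz; now left|]. intros i Pi. apply le_epsilon. intros e He.
    apply (Hz (ball e i)). right. exists i, e. auto.
Qed.
End Balls.

(** * Extension of nonexpansive maps *)

(** Zorn's lemma for sets that are pairwise compatible together with [S0]; adjoining [S0] in the
    predicate also covers the empty chain. *)
Lemma maximal_compatible {T} (Q : T -> T -> Prop) (S0 : T -> Prop) :
  (forall p q, S0 p -> S0 q -> Q p q) ->
  exists S, (forall p, S0 p -> S p) /\ (forall p q, S p -> S q -> Q p q) /\
    forall t, Q t t -> (forall p, S p -> Q p t /\ Q t p) -> S t.
Proof.
  intros H0.
  destruct (@classical_sets.Zorn_bigcup T
    (fun S : T -> Prop => forall p q : T, S p \/ S0 p -> S q \/ S0 q -> Q p q)) as (S & HS & Hmax).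
  - intros F HF Htot p q [[S1 F1 Hp]|Hp] [[S2 F2 Hq]|Hq]; auto.
    + destruct (Htot S1 S2 F1 F2) as [H|H].
      * apply (HF S2 F2); left; auto.
      * apply (HF S1 F1); left; auto.
    + apply (HF S1 F1); auto.
    + apply (HF S2 F2); auto.
  - exists (fun p => S p \/ S0 p). split; [auto|]. split; [exact HS|].
    intros t Qt Ht. apply NNPP. intros Hnt.
    apply (Hmax (fun p => S p \/ p = t)).
    + split; [intros p Hp; now left|]. intros H. apply Hnt. left. apply H. now right.
    + intros p q [[Hp| ->]|Hp] [[Hq| ->]|Hq]; auto; apply Ht; auto.
Qed.

Section Extension.
Context {X Y : Type} (dX : X -> X -> R) (dY : Y -> Y -> R) (kappa : R).
Hypothesis HdX : is_metric dX.
Hypothesis HdY : is_metric dY.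
Hypothesis Hk : kappa <= 0.
Hypothesis HX : CBB kappa dX.
Hypothesis HY : CAT kappa dY.
Hypothesis Hcomplete : complete dY.

Let muX x x' := md kappa (dX x x').
Let muY y y' := md kappa (dY y y').

Variables (Z : Y -> Prop) (h : X -> Y) (sigma : R).
Hypothesis HZ : closed_midconvex dY Z.
Hypothesis Hsigma : 0 <= sigma.
Hypothesis HhZ : forall x, Z (h x).
Hypothesis Hh : forall x x', muY (h x) (h x') <= muX x x' + 2 * sigma.

(* Modified distance between [(x, 0)] and [(x', s)], [md kappa s = sigma], in the product of
   [X] and a line: the Euclidean product for curvature 0, and the product warped by
   [cosh] for negative curvature, where [cosh d = cosh (dX x x') * cosh s]. *)
Let lift m := (1 - kappa * sigma) * m + sigma.

(** Points at height [s] receive weight [1 - kappa * sigma]. Then the form required by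
    [balls_intersection] is, term by term, at most the Sturm form of [X] at [x]: between two such
    points the lifted radii yield [- 2 * sigma], which absorbs the defect of [h]. *)
Lemma one_point_extension (S : X * Y -> Prop) x :
  (forall p, S p -> Z (snd p)) ->
  (forall p q, S p -> S q -> muY (snd p) (snd q) <= muX (fst p) (fst q)) ->
  (forall p x', S p -> muY (snd p) (h x') <= lift (muX (fst p) x')) ->
  exists z, Z z /\ (forall p, S p -> muY (snd p) z <= muX x (fst p)) /\
    forall x', muY (h x') z <= lift (muX x x').
Proof.
  intros SZ SS Sh.
  (* The tag [false] marks points of the partial graph at height 0, the tag [true] points of the
     graph of [h] at height [s]. *)
  set (P := fun i : bool * (X * Y) => if fst i then snd (snd i) = h (fst (snd i)) else S (snd i)).
  set (r := fun i : bool * (X * Y) => if fst i then lift (muX x (fst (snd i))) else muX x (fst (snd i))).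
  set (w := fun i : bool * (X * Y) => if fst i then 1 - kappa * sigma else 1).
  assert (Hm : forall a b, 0 <= muX a b) by (intros; now apply md_nonneg).
  assert (Hks : 0 <= - kappa * sigma) by nra.
  destruct (balls_intersection dY kappa HdY Hk HY Z P (fun i => snd (snd i)) r HZ) as (z & Hz & Hb).
  - intros [[] [b y]]; unfold P; simpl; [intros ->; apply HhZ | apply SZ].
  - intros [[] [b y]] _; unfold r, lift; simpl; [|apply Hm]. specialize (Hm x b). nra.
  - intros l Hl.
    pose proof (sturm_inequality dX kappa x (map (fun i => (w i, fst (snd i))) l) HdX Hk HX) as St.
    rewrite lsum_map in St. refine (Rle_trans _ _ _ _ (St _)).
    + apply lsum_le. intros i Hi. rewrite lsum_map. apply lsum_le. intros j Hj. simpl.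
      assert (Eq : md kappa (dX (fst (snd i)) x) = muX x (fst (snd i))).
      { unfold muX. now rewrite (metric_sym dX HdX x). }
      rewrite Eq. clear Eq.
      pose proof (Hl i Hi) as Pi. pose proof (Hl j Hj) as Pj.
      destruct i as [[] p]; destruct j as [[] q]; unfold P, r, w, lift, incr in *; simpl in *;
        fold (muX x (fst q)); fold (muX (fst p) (fst q)); fold (muY (snd p) (snd q)).
      * rewrite Pi, Pj. pose proof (Hh (fst p) (fst q)). pose proof (Hm (fst p) (fst q)).
        assert (muX (fst p) (fst q) <= (1 - kappa * sigma) * (1 - kappa * sigma) * muX (fst p) (fst q)).
        { assert (1 <= (1 - kappa * sigma) * (1 - kappa * sigma)) by nra. nra. }
        assert (0 <= - kappa * (sigma * sigma)) by nra. lra.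
      * pose proof (Sh q (fst p) Pj) as Sq.
        assert (E1 : muY (snd p) (snd q) = muY (snd q) (h (fst p))) by (rewrite Pi; unfold muY; now rewrite (metric_sym dY HdY (snd q))).
        assert (E2 : muX (fst q) (fst p) = muX (fst p) (fst q)) by (unfold muX; now rewrite (metric_sym dX HdX (fst q))).
        rewrite E1. rewrite E2 in Sq. unfold lift in Sq. lra.
      * pose proof (Sh p (fst q) Pi) as Sp. rewrite Pj. unfold lift in Sp. lra.
      * pose proof (SS p q Pi Pj). lra.
    + intros i Hi. apply in_map_iff in Hi as (j & <- & _). simpl. unfold w. destruct (fst j); nra.
  - exact Hcomplete.
  (* This ball is available even when [S] is empty. *)
  - exists (true, (x, h x)). reflexivity.
  - exists z. split; [exact Hz|]. split.
    + intros p Sp. apply (Hb (false, p) Sp).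
    + intros x'. apply (Hb (true, (x', h x')) eq_refl).
Qed.

(** A maximal partial graph that contains [g], is nonexpansive and is compatible with the lifted [h]
    is total by [one_point_extension]. Closeness to [h] is compatibility of the two points over the
    same [x], because [lift 0 = sigma]. *)
Lemma extension_near (A : X -> Prop) (g : X -> Y) :
  (forall a, A a -> Z (g a)) ->
  (forall a b, A a -> A b -> dY (g a) (g b) <= dX a b) ->
  (forall a x, A a -> muY (g a) (h x) <= lift (muX a x)) ->
  exists k, (forall x, Z (k x)) /\ (forall a, A a -> k a = g a) /\
    (forall x x', dY (k x) (k x') <= dX x x') /\ (forall x, muY (h x) (k x) <= sigma).
Proof.
  intros gZ gg gh.
  set (Q := fun p q : X * Y => Z (snd p) /\ muY (snd p) (snd q) <= muX (fst p) (fst q) /\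
    forall x', muY (snd p) (h x') <= lift (muX (fst p) x')).
  destruct (maximal_compatible Q (fun p => A (fst p) /\ snd p = g (fst p))) as (S & S0 & SQ & Smax).
  { intros [a y] [b y'] [Ha Ey] [Hb Ey']. simpl in *. subst.
    split; [now apply gZ|]. split; [|intros x'; now apply gh].
    apply md_le; [assumption | now apply metric_nonneg | now apply gg]. }
  assert (Hself : forall x, muX x x = 0) by (intros; unfold muX; rewrite metric_self, md_0; trivial).
  assert (Tot : forall x, exists y, S (x, y)).
  { intros x. destruct (one_point_extension S x) as (z & Hz & Hz1 & Hz2).
    - intros p Sp. apply (SQ p p Sp Sp).
    - intros p q Sp Sq. apply (SQ p q Sp Sq).
    - intros p x' Sp. apply (SQ p p Sp Sp).
    - assert (Hz3 : forall x', muY z (h x') <= lift (muX x x')).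
      { intros x'. unfold muY. rewrite (metric_sym dY HdY z). apply Hz2. }
      exists z. apply Smax.
      + split; [exact Hz|]. split; [|exact Hz3]. simpl. rewrite Hself. unfold muY.
        rewrite metric_self, md_0; trivial; lra.
      + intros p Sp. split; (split; [try exact Hz; apply (SQ p p Sp Sp)|]); (split; [|try exact Hz3; apply (SQ p p Sp Sp)]); simpl.
        * unfold muX. rewrite (metric_sym dX HdX (fst p)). now apply Hz1.
        * unfold muY. rewrite (metric_sym dY HdY z). now apply Hz1. }
  destruct (functional_choice _ Tot) as (k & Sk). exists k.
  assert (Hkk : forall p q, S p -> S q -> dY (snd p) (snd q) <= dX (fst p) (fst q)).
  { intros p q Sp Sq. apply (md_le_inv kappa Hk); [now apply metric_nonneg|]. apply (SQ p q Sp Sq). }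
  split; [|split; [|split]].
  - intros x. apply (SQ (x, k x) (x, k x)); apply Sk.
  - intros a Ha. apply (metric_zero dY HdY). apply Rle_antisym; [|now apply metric_nonneg].
    rewrite <- (metric_self dX HdX a).
    apply (Hkk (a, k a) (a, g a)); [apply Sk | apply S0; split; trivial].
  - intros x x'. apply (Hkk (x, k x) (x', k x')); apply Sk.
  - intros x. destruct (SQ (x, k x) (x, k x) (Sk x) (Sk x)) as (_ & _ & H). specialize (H x). simpl in H.
    unfold lift in H. rewrite Hself in H. unfold muY in *. rewrite (metric_sym dY HdY (h x)). lra.
Qed.
End Extension.

(** * Lower semi-continuity of the extension mapping *)

Theorem theorem4p6 (kappa : R) (X Y : Type) (dX : X -> X -> R) (dY : Y -> Y -> R)
  (A : X -> Prop) :
  kappa <= 0 -> is_metric dX -> is_metric dY ->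
  CBB kappa dX -> CAT kappa dY -> complete dY -> (exists a, A a) ->
  Phi_c_lsc dX dY A.
Proof.
  intros Hk HdX HdY HX HY Hcomp [a0 Ha0] V HV f Hf (h & (Hh & Hhf & Hhco) & Vh).
  destruct (HV h Hh Vh) as (eps & Heps & HVh).
  destruct Hh as [Hh1 (M & HM)].
  assert (HM0 : 0 <= M).
  { rewrite <- (metric_self dY HdY (h a0)). now apply HM. }
  (* By [md_ge], a modified distance at most [sigma] means a distance at most [eps / 4]. *)
  set (sigma := eps * eps / 32). assert (Hsigma : 0 < sigma) by (unfold sigma; nra).
  set (lip := sn kappa (M + 4)).
  assert (Hlip : 0 <= lip) by (apply sn_nonneg; [assumption | lra]).
  (* The bounds keep distances below [M + 4], make [2 * delta] at most [eps / 4], and make a change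
     of [4 * delta] in distance cost at most [sigma] in [md]. *)
  set (delta := Rmin (Rmin 1 (eps / 8)) (sigma / (4 * (lip + 1)))).
  assert (Hd0 : 0 < delta).
  { apply Rmin_glb_lt; [apply Rmin_glb_lt; lra | apply Rdiv_lt_0_compat; lra]. }
  assert (Hd12 : delta <= Rmin 1 (eps / 8)) by apply Rmin_l.
  assert (Hd1 : delta <= 1) by (pose proof (Rmin_l 1 (eps / 8)); lra).
  assert (Hd2 : delta <= eps / 8) by (pose proof (Rmin_r 1 (eps / 8)); lra).
  assert (Hd3 : lip * (4 * delta) <= sigma).
  { assert (E : delta <= sigma / (4 * (lip + 1))) by apply Rmin_r.
    apply (Rmult_le_compat_r (4 * (lip + 1))) in E; [|lra].
    replace (sigma / (4 * (lip + 1)) * (4 * (lip + 1))) with sigma in E by (field; lra). nra. }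
  assert (Shift : forall x x' v, 0 <= v -> v <= dY (h x) (h x') + 4 * delta ->
    md kappa v <= md kappa (dX x x') + sigma).
  { intros x x' v Hv Hv'. pose proof (Hh1 x x' I I) as N1. pose proof (HM x x' I I) as N2.
    pose proof (metric_nonneg dY HdY (h x) (h x')) as N0.
    pose proof (md_le kappa Hk _ _ N0 N1).
    pose proof (md_le kappa Hk _ _ Hv Hv').
    pose proof (md_lipschitz kappa Hk (M + 4) (dY (h x) (h x') + 4 * delta) (dY (h x) (h x')) ltac:(lra) ltac:(lra)) as L.
    fold lip in L. replace (dY (h x) (h x') + 4 * delta - dY (h x) (h x')) with (4 * delta) in L by ring.
    rewrite Rabs_right in L by lra. lra. }
  exists delta. split; [exact Hd0|]. intros g [Hg1 _] (m & [Hub _] & Hm).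
  assert (Hfg : forall a, A a -> dY (f a) (g a) < delta).
  { intros a Ha. eapply Rle_lt_trans; [apply Hub; eauto | exact Hm]. }
  set (gA := fun y => exists a, A a /\ y = g a).
  (* The closed [delta]-neighbourhood of [co dY gA] is convex and contains [f(A)], hence also the
     closed hull, where [h] takes its values. The second [delta] pays for choosing an actual
     point. *)
  assert (Hnear : forall x, exists y, co dY gA y /\ dY (h x) y < 2 * delta).
  { intros x. assert (N : thickening dY delta (co dY gA) (h x)).
    { apply (closed_co_least dY HdY (fun y => exists a, A a /\ y = f a)); [| |apply Hhco].
      - apply (thickening_closed_midconvex dY HdY kappa Hk HY). apply (co_midconvex dY kappa HY).
      - intros y (a & Ha & ->) e He. exists (g a).
        split; [apply (subset_co dY kappa HY); now exists a|]. specialize (Hfg a Ha). lra. }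
    destruct (N delta Hd0) as (y & Hy & Dy). exists y. split; [exact Hy|lra]. }
  destruct (functional_choice _ Hnear) as (h' & Hh').
  (* Hence [md + sigma] is at most the lifted distance [(1 - kappa * sigma) * md + sigma]. *)
  assert (Hmd : forall x x', 0 <= - kappa * sigma * md kappa (dX x x')).
  { intros. apply Rmult_le_pos; [nra | now apply md_nonneg]. }
  destruct (extension_near dX dY kappa HdX HdY Hk HX HY Hcomp (closed_co dY gA) h' sigma) with (A := A) (g := g)
    as (k & kZ & kg & kk & kh).
  - now apply (closed_co_closed_midconvex dY HdY kappa).
  - lra.
  - intros x. apply (co_subset_closed_co dY HdY), Hh'.
  - intros x x'. apply Rle_trans with (md kappa (dX x x') + sigma); [|lra].
    apply Shift; [now apply metric_nonneg|].
    pose proof (metric_triangle dY HdY (h' x) (h x) (h' x')) as T1.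
    pose proof (metric_triangle dY HdY (h x) (h x') (h' x')) as T2.
    rewrite (metric_sym dY HdY (h' x) (h x)) in T1.
    pose proof (proj2 (Hh' x)). pose proof (proj2 (Hh' x')). lra.
  - intros a Ha. apply (co_subset_closed_co dY HdY), (subset_co dY kappa HY). now exists a.
  - exact Hg1.
  - intros a x Ha. apply Rle_trans with (md kappa (dX a x) + sigma); [|specialize (Hmd a x); lra].
    apply Shift; [now apply metric_nonneg|].
    pose proof (metric_triangle dY HdY (g a) (f a) (h' x)) as T1.
    pose proof (metric_triangle dY HdY (f a) (h x) (h' x)) as T2.
    rewrite (metric_sym dY HdY (g a) (f a)) in T1. rewrite (Hhf a Ha).
    pose proof (proj2 (Hh' x)). specialize (Hfg a Ha). lra.
  (* At most [2 * delta <= eps / 4] from [h] to [h'], and [eps / 4] from [h'] to [k]. *)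
  - assert (Hhk : forall x, dY (h x) (k x) <= eps / 2).
    { intros x. pose proof (metric_triangle dY HdY (h x) (h' x) (k x)) as T1.
      pose proof (md_ge kappa Hk (dY (h' x) (k x))) as T2. specialize (kh x).
      assert (dY (h' x) (k x) <= eps / 4) by (unfold sigma in kh; nra).
      pose proof (proj2 (Hh' x)). lra. }
    assert (Hkb : nonexp_bounded dX dY (fun _ => True) k).
    { split; [auto|]. exists (M + eps). intros x x' _ _. specialize (HM x x' I I).
      pose proof (metric_triangle dY HdY (k x) (h x) (k x')) as T1.
      pose proof (metric_triangle dY HdY (h x) (h x') (k x')) as T2.
      rewrite (metric_sym dY HdY (k x) (h x)) in T1. pose proof (Hhk x). pose proof (Hhk x'). lra. }
    exists k. split; [split; [exact Hkb|]; split; assumption|].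
    apply HVh; [exact Hkb|].
    (* The uniform bound [eps / 2] leaves room for the supremum to stay strictly below [eps]. *)
    destruct (completeness (fun r => exists a, True /\ r = dY (h a) (k a))) as (s & Hs).
    + exists (eps / 2). intros r (x & _ & ->). apply Hhk.
    + exists (dY (h a0) (k a0)), a0. auto.
    + exists s. split; [exact Hs|]. apply Rle_lt_trans with (eps / 2); [|lra].
      apply Hs. intros r (x & _ & ->). apply Hhk.
Qed.
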